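(* Let $n\ge 4$. Any canal space-like hypersurface $M$ ($\dim M=n$) in the Minkowski space $\mathbb{R}^{n+1}_1$ is a Riemannian QC-manifold with negative horizontal sectional curvatures.
   Context: QC-manifolds. $(M,g,\xi)$ denotes an $n$-dimensional Riemannian manifold with metric $g$ and a unit vector field $\xi$. It is a Riemannian manifold of quasi-constant sectional curvatures (Riemannian QC-manifold) if for every $p\in M$ and every 2-plane $E\subset T_pM$ the sectional curvature of $E$ depends only on $p$ and on the angle between $E$ and $\xi$. The sectional curvatures of 2-planes in $T_pM$ perpendicular to $\xi$ then all have one and the same value, called the horizontal sectional curvature at $p$. Canal space-like hypersurfaces. $\mathbb{R}^{n+1}_1$ is Minkowski space with scalar product of signature $(n,1)$; products of vectors are scalar products. A hypersurface $M$ of dimension $n$ is space-like if the induced metric is positive definite. A space-like hypersphere with center $z$ and radius $R>0$ is $\{Z:(Z-z)^2=-R^2\}$. A sphere of codimension two is an $(n-1)$-dimensional cross-section $S^{n-1}$ of a space-like hypersphere with a hyperplane. A canal space-like hypersurface is a space-like hypersurface $M=\{S^{n-1}(s)\}$, $s\in J\subset\mathbb R$, which is a one-parameter family of spheres of codimension two (spherical generators) such that the normals to $M$ at the points of any fixed generator $S^{n-1}(s)$ pass through a fixed point $z(s)$. Its position vector $Z$ then satisfies $(Z-z(s))^2=-R^2(s)$ and $(Z-z(s))\,z'(s)=R(s)R'(s)$, with $R(s)>0$. Such an $M$ is endowed with the induced metric $g$ and the unit tangent vector field $\xi=\frac{t-R'N}{\sqrt{(t-R'N)^2}}$, where $t=z'$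 and $N=-\frac{Z-z}{R}$ is the unit normal ($N^2=-1$). *)

(* Defs.v *)
From HB Require Import structures.
From mathcomp Require Import all_boot all_order all_algebra.
From mathcomp Require Import all_classical all_reals all_analysis.

Set Implicit Arguments.
Unset Strict Implicit.
Unset Printing Implicit Defensive.

Import Order.TTheory GRing.Theory Num.Theory.
Import numFieldNormedType.Exports.

Local Open Scope classical_set_scope.
Local Open Scope ring_scope.

Section Smoothness.
Context {R : realType}.

(* C^infinity on an open set A: every iterated directional derivative of f is
   (Frechet) differentiable at every point of A. *)
Definition smooth_on (V W : normedModType R) (A : set V) (f : V -> W) : Prop :=
  forall (vs : seq V) (x : V), A x ->
    differentiable (foldr (fun v (h : V -> W) => fun y => 'D_v h y) f vs) x.

End Smoothness.

Section RiemannianCharts.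
Context {R : realType} {n : nat}.

(* A metric in a chart is the matrix-valued function u |-> (g_ij(u)). *)
Implicit Types (g : 'rV[R]_n -> 'M[R]_n) (u a b c : 'rV[R]_n).

Definition partial (i : 'I_n) (f : 'rV[R]_n -> R) (u : 'rV[R]_n) : R :=
  'D_(delta_mx 0 i) f u.

(* Gamma^k_ij of the Levi-Civita connection. *)
Definition christoffel g (k i j : 'I_n) u : R :=
  2^-1 * \sum_(l < n) invmx (g u) k l *
    (partial i (fun v => g v j l) u + partial j (fun v => g v i l) u
     - partial l (fun v => g v i j) u).

(* The l-th component of R(d_i, d_j) d_k, for the sign convention
   R(X, Y) Z = nabla_X nabla_Y Z - nabla_Y nabla_X Z - nabla_[X, Y] Z. *)
Definition riemann_coef g (i j k l : 'I_n) u : R :=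
  partial i (christoffel g l j k) u - partial j (christoffel g l i k) u
  + \sum_(m < n) (christoffel g m j k u * christoffel g l i m u
                  - christoffel g m i k u * christoffel g l j m u).

Definition riemann g u a b c : 'rV[R]_n :=
  \row_l \sum_(i < n) \sum_(j < n) \sum_(k < n)
    a 0 i * b 0 j * c 0 k * riemann_coef g i j k l u.

Definition metric_form g u a b : R :=
  \sum_(i < n) \sum_(j < n) g u i j * a 0 i * b 0 j.

(* With this sign a round sphere has positive curvature. *)
Definition sectional g u a b : R :=
  metric_form g u (riemann g u a b b) a /
  (metric_form g u a a * metric_form g u b b - metric_form g u a b ^+ 2).

End RiemannianCharts.

Section Minkowski.
Context {R : realType} {n : nat}.

Implicit Types (M : set 'rV[R]_n.+1) (p v x y : 'rV[R]_n.+1).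

(* Signature (n, 1); the last coordinate is the time coordinate. *)
Definition mink x y : R :=
  \sum_(i < n) x 0 (lift ord_max i) * y 0 (lift ord_max i)
  - x 0 ord_max * y 0 ord_max.

(* The norm of a space-like vector. *)
Definition mnorm x : R := Num.sqrt (mink x x).

(* X : U -> M is a local parametrization of the embedded hypersurface M: a
   smooth immersion which is a homeomorphism onto a relatively open part of M
   (the last clause contains the continuity of the inverse). *)
Definition local_param M (U : set 'rV[R]_n) (X : 'rV[R]_n -> 'rV[R]_n.+1) :
    Prop :=
  [/\ open U,
      smooth_on U X,
      (forall u a, U u -> 'D_a X u = 0 -> a = 0),
      set_inj U X
    & forall U', open U' -> U' `<=` U ->
        exists V, open V /\ X @` U' = M `&` V].

Definition hypersurface M : Prop :=
  forall p, M p -> exists U X u, [/\ local_param M U X, U u & X u = p].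

Definition tangent M p v : Prop :=
  exists U X u a, [/\ local_param M U X, U u, X u = p & 'D_a X u = v].

Definition spacelike M : Prop :=
  forall p v, M p -> tangent M p v -> v != 0 -> 0 < mink v v.

Definition normal M p v : Prop := forall w, tangent M p w -> mink v w = 0.

Definition normal_line_through M p v : Prop :=
  exists w, normal M p w /\ v = p + w.

Definition induced_metric (X : 'rV[R]_n -> 'rV[R]_n.+1) (u : 'rV[R]_n) :
    'M[R]_n :=
  \matrix_(i, j) mink ('D_(delta_mx 0 i) X u) ('D_(delta_mx 0 j) X u).

(* k is the sectional curvature, for the induced metric, of the 2-plane of
   T_pM spanned by x and y, computed in some local parametrization. *)
Definition curvature_of_plane M p x y (k : R) : Prop :=
  exists U X u a b,
    [/\ local_param M U X, U u, X u = p,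
        'D_a X u = x /\ 'D_b X u = y
      & k = sectional (induced_metric X) u a b].

(* 2-planes are given by orthonormal bases. *)
Definition orthonormal_pair x y : Prop :=
  [/\ mink x x = 1, mink y y = 1 & mink x y = 0].

(* The angle, in [0, pi / 2], between v and the plane with orthonormal basis
   (x, y), i.e. between v and its orthogonal projection to this plane. *)
Definition plane_angle x y v : R :=
  acos (mnorm (mink v x *: x + mink v y *: y) / mnorm v).

Definition unit_tangent_field M (xi : 'rV[R]_n.+1 -> 'rV[R]_n.+1) : Prop :=
  [/\ (forall p, M p -> tangent M p (xi p)),
      (forall p, M p -> mink (xi p) (xi p) = 1)
    & forall U X, local_param M U X -> smooth_on U (xi \o X)].

(* (M, g, xi) is a Riemannian QC-manifold, g being the induced metric. The
   function kappa of the angle does not depend on the parametrizations. *)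
Definition QC_manifold M (xi : 'rV[R]_n.+1 -> 'rV[R]_n.+1) : Prop :=
  [/\ hypersurface M, spacelike M, unit_tangent_field M xi
    & forall p, M p -> exists kappa : R -> R,
        forall x y k, orthonormal_pair x y -> curvature_of_plane M p x y k ->
          k = kappa (plane_angle x y (xi p))].

(* k is the sectional curvature of some 2-plane of T_pM perpendicular to xi. *)
Definition horizontal_curvature M (xi : 'rV[R]_n.+1 -> 'rV[R]_n.+1) p (k : R) :
    Prop :=
  exists x y, [/\ orthonormal_pair x y, mink (xi p) x = 0, mink (xi p) y = 0
                & curvature_of_plane M p x y k].

Definition spacelike_hypersphere (c : 'rV[R]_n.+1) (rho : R) :
    set 'rV[R]_n.+1 :=
  [set Z | mink (Z - c) (Z - c) = - rho ^+ 2].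

(* The hyperplane is [set Z | mink m Z = d]. The section has dimension n - 1:
   it is not empty, and the hyperplane is nowhere tangent to the hypersphere,
   whose normal at Z is Z - c. The hyperplane may be space-like, time-like or
   light-like. *)
Definition codim2_sphere (S : set 'rV[R]_n.+1) : Prop :=
  exists (c : 'rV[R]_n.+1) (rho : R) (m : 'rV[R]_n.+1) (d : R),
    [/\ 0 < rho,
        m != 0,
        S = spacelike_hypersphere c rho `&` [set Z | mink m Z = d],
        S !=set0
      & forall Z (lam : R), S Z -> m != lam *: (Z - c)].

(* The family S is a smooth one-parameter family: near each point p0 of S s0
   the parameter is a smooth function sigma on M without critical points
   (a smooth function on M being locally the restriction of a smooth function
   of the ambient space). *)
Definition smooth_family M (J : set R) (S : R -> set 'rV[R]_n.+1) : Prop :=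
  forall s0 p0, J s0 -> S s0 p0 ->
    exists (V : set 'rV[R]_n.+1) (sigma : 'rV[R]_n.+1 -> R),
      [/\ open V /\ V p0,
          smooth_on V sigma,
          sigma p0 = s0,
          (forall p, M p -> V p -> J (sigma p) /\ S (sigma p) p)
        & exists v, tangent M p0 v /\ 'D_v sigma p0 != 0].

(* M is the union of the generators S s, s in J. The function r is introduced
   by (Z - z)^2 = - r^2; the relation (Z - z) z' = r r' is a consequence. When
   z' = 0 the vector t - r' N vanishes and the field xi does not exist. *)
Definition canal_spacelike_hypersurface M (J : set R) (S : R -> set 'rV[R]_n.+1)
    (z : R -> 'rV[R]_n.+1) (r : R -> R) : Prop :=
  [/\ hypersurface M /\ spacelike M,
      open J /\ is_interval J,
      M = \bigcup_(s in J) S s /\ (forall s, J s -> codim2_sphere (S s)),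
      smooth_family M J S
    & [/\ smooth_on J z /\ smooth_on J r,
          (forall s, J s -> derive1 z s != 0),
          (forall s, J s -> 0 < r s),
          (forall s p, J s -> S s p -> normal_line_through M p (z s))
        & forall s p, J s -> S s p -> mink (p - z s) (p - z s) = - r s ^+ 2]].

Definition canal_normal (z : R -> 'rV[R]_n.+1) (r : R -> R) (s : R) p :
    'rV[R]_n.+1 :=
  - ((r s)^-1 *: (p - z s)).

(* The vector xi = (t - r' N) / |t - r' N|, t = z', at a point p of the
   generator S s. *)
Definition canal_direction (z : R -> 'rV[R]_n.+1) (r : R -> R) (s : R) p :
    'rV[R]_n.+1 :=
  let w := derive1 z s - derive1 r s *: canal_normal z r s p in (mnorm w)^-1 *: w.

End Minkowski.

(* Main.v *)
Require Import Defs.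
From HB Require Import structures.
From mathcomp Require Import all_boot all_order all_algebra.
From mathcomp Require Import all_classical all_reals all_analysis.
From mathcomp Require Import ring lra.

(** A point of the hypersurface lies on a generator with parameter [s], and the
    condition on the normals says that [N = - (X - z) / r] is the unit normal
    there. Differentiating [(X - z)^2 = - r^2] in a direction along which the
    parameter varies gives [<X - z, z'> = r r'] ([center_velocity]), so that
    [w = z' - r' N] is orthogonal to [N], hence tangent by a dimension count. It
    is nonzero: otherwise the generator would reduce to one point, whereas a
    section of a hypersphere by a transverse hyperplane has at least two
    ([codim2_sphere_two_points], [canal_vector_gt0]). As the tangent space is
    space-like, [xi = w / |w|] is a well defined unit tangent field, smooth as a
    smooth expression of the parameter and the position ([Ck_canal_direction]).

    Differentiating [X = z - r N] gives [r dN = w dtau - dX], where [tau] is the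
    parameter as a function on a chart, and differentiating [<X - z, z'> = r r']
    gives [<w, dX> = f dtau] with a scalar [f] depending on the point only
    ([param_factorE]). The second fundamental form is therefore
    [h = (f dtau dtau - g) / r = (lam eta eta - g) / r], where [eta] is the
    covector dual to [xi] and [lam = |w|^2 / f] ([canal_second_form]). Since the
    normal is time-like, the Gauss equation ([gauss_equation]) makes the
    sectional curvature of a plane with orthonormal basis [(x, y)] equal to
    [- (h(x,x) h(y,y) - h(x,y)^2)], that is
    [- (1 - lam (eta(x)^2 + eta(y)^2)) / r^2] ([canal_sectional]). The sum of
    squares is the squared cosine of the angle between [xi] and the plane, which
    is the quasi-constancy, and it vanishes on planes orthogonal to [xi], whose
    curvature is thus [- 1 / r^2].

    The Gauss equation is established in coordinates from the definition of the
    Christoffel symbols; it rests on the symmetry of second derivatives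
    ([derive_comm]). *)

Set Implicit Arguments.
Unset Strict Implicit.
Unset Printing Implicit Defensive.

Import Order.TTheory GRing.Theory Num.Theory.
Import numFieldNormedType.Exports.

Local Open Scope classical_set_scope.
Local Open Scope ring_scope.

(** * Pointwise differential calculus *)

Section PointwiseCalculus.
Context {R : realType} {V : normedModType R}.
Implicit Types (x v : V).

Lemma near_eq_differentiable (W : normedModType R) (f g : V -> W) x :
  (\near x, f x = g x) -> differentiable f x -> differentiable g x.
Proof.
move=> fg df.
have cf : continuous ('d f x) by case: df => -[].
have eqg : g \o shift x = cst (g x) + 'd f x +o_ 0 id.
  apply/eqaddoP => e e0.
  have /diff_locallyP[_ /eqaddoP/(_ _ e0) fe] := df.
  have fg0 : \forall h \near (0 : V), f (h + x) = g (h + x).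
    by move: fg; rewrite (near_shift 0 x) /=; apply: filterS => h /=; rewrite subr0.
  near=> h.
  have -> : (g \o shift x - (cst (g x) + 'd f x)) h =
            (f \o shift x - (cst (f x) + 'd f x)) h.
    by rewrite !fctE /=; rewrite -(nbhs_singleton fg) (near fg0 h).
  by near: h.
by apply/diff_locallyP; rewrite (diff_unique cf eqg).
Unshelve. all: by end_near. Qed.

Lemma differentiable_bigsum (W : normedModType R) (I : Type) (s : seq I) (P : pred I)
    (f : I -> V -> W) x :
  (forall i, differentiable (f i) x) ->
  differentiable (fun y => \sum_(i <- s | P i) f i y) x.
Proof.
move=> df; elim: s => [|i s IH].
  by under eq_fun do rewrite big_nil; exact: differentiable_cst.
under eq_fun do rewrite big_cons.
by case: (P i) => //; exact: differentiableD.
Qed.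

Lemma derive_bigsum (W : normedModType R) (I : Type) (s : seq I) (P : pred I)
    (f : I -> V -> W) x v :
  (forall i, differentiable (f i) x) ->
  'D_v (fun y => \sum_(i <- s | P i) f i y) x = \sum_(i <- s | P i) 'D_v (f i) x.
Proof.
move=> df; elim: s => [|i s IH].
  by under eq_fun do rewrite big_nil; rewrite big_nil derive_cst.
under eq_fun do rewrite big_cons.
rewrite big_cons; case: (P i) => //.
rewrite -IH [LHS]deriveD //; first exact: diff_derivable.
by apply: diff_derivable; exact: differentiable_bigsum.
Qed.

Lemma deriveMf (f g : V -> R) x v :
  differentiable f x -> differentiable g x ->
  'D_v (fun y => f y * g y) x = 'D_v f x * g x + f x * 'D_v g x.
Proof.
move=> df dg; rewrite [LHS]deriveM; try exact: diff_derivable.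
by rewrite addrC /= [in X in X + _]/GRing.scale /= mulrC.
Qed.

(** The entries are composites with continuous linear forms; conversely the map
    is the sum of its entries times the matrix units. *)
Lemma differentiable_mxP m n (f : V -> 'M[R]_(m, n)) x :
  differentiable f x <-> forall i j, differentiable (fun y => f y i j) x.
Proof.
split=> [df i j|df].
  exact: (@differentiable_comp _ _ _ _ f (fun N : 'M[R]_(m, n) => N i j) x df
           (differentiable_coord _ _ _)).
have -> : f = fun y => \sum_i \sum_j f y i j *: delta_mx i j.
  by apply/funext => y; exact: matrix_sum_delta.
apply: differentiable_bigsum => i; apply: differentiable_bigsum => j; exact: differentiableZl.
Qed.

Lemma derive_coord m n (f : V -> 'M[R]_(m, n)) x v i j :
  differentiable f x -> 'D_v f x i j = 'D_v (fun y => f y i j) x.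
Proof. by move=> df; rewrite derive_mx ?mxE //; exact: diff_derivable. Qed.

Lemma derive_comp1 (W : normedModType R) (f : V -> R) (F : R -> W) x v :
  differentiable f x -> differentiable F (f x) ->
  'D_v (fun y => F (f y)) x = 'D_v f x *: 'D_1 F (f x).
Proof.
move=> df dF; rewrite [LHS](deriveE _ (differentiable_comp df dF)).
rewrite diff_comp //= !deriveE // -[X in 'd F _ X]mulr1.
by rewrite [LHS]linearZ.
Qed.

Lemma derive_comp (V' W : normedModType R) (f : V -> V') (F : V' -> W) x v :
  differentiable f x -> differentiable F (f x) ->
  'D_v (fun y => F (f y)) x = 'D_('D_v f x) F (f x).
Proof.
move=> df dF; rewrite [LHS](deriveE _ (differentiable_comp df dF)).
by rewrite diff_comp //= -deriveE // -deriveE.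
Qed.

Lemma derive_rowE (W : normedModType R) m (F : 'rV[R]_m -> W) y w :
  differentiable F y ->
  'D_w F y = \sum_i w 0 i *: 'D_(delta_mx 0 i) F y.
Proof.
move=> dF; rewrite deriveE // [w in LHS]row_sum_delta linear_sum.
by apply: eq_bigr => i _; rewrite linearZ deriveE.
Qed.

Lemma derive_comp_row (W : normedModType R) m (f : V -> 'rV[R]_m)
    (F : 'rV[R]_m -> W) x v :
  differentiable f x -> differentiable F (f x) ->
  'D_v (fun y => F (f y)) x =
  \sum_i 'D_v (fun y => f y 0 i) x *: 'D_(delta_mx 0 i) F (f x).
Proof.
move=> df dF; rewrite [LHS](deriveE _ (differentiable_comp df dF)).
rewrite diff_comp //= -deriveE // derive_rowE //.
by apply: eq_bigr => i _; rewrite -deriveE // derive_coord.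
Qed.

End PointwiseCalculus.

(** * Closure properties of smooth maps *)

Section SmoothCalculus.
Context {R : realType}.

(** Differentiability to a finite order, so that products and composites can be
    treated by induction on the order: the derivative of a product or composite
    involves the maps themselves together with their derivatives, at one order
    less. *)
Fixpoint Ck (V W : normedModType R) (k : nat) (A : set V) (f : V -> W) : Prop :=
  (forall x, A x -> differentiable f x) /\
  if k is k'.+1 then forall v, Ck k' A (fun x => 'D_v f x) else True.

Lemma Ck_differentiable (V W : normedModType R) k (A : set V) (f : V -> W) x :
  Ck k A f -> A x -> differentiable f x.
Proof. by case: k => [|k] [df _]; exact: df. Qed.

Lemma smooth_onP (V W : normedModType R) (A : set V) (f : V -> W) :
  smooth_on A f <-> forall k, Ck k A f.
Proof.
split=> [sf k|cf vs].
  elim: k f sf => [|k IH] f sf; first by split=> // x; exact: (sf [::]).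
  split=> [x|v]; first exact: (sf [::]).
  by apply: IH => vs x Ax; have := sf (rcons vs v) x Ax; rewrite foldr_rcons.
elim/last_ind: vs f cf => [|vs v IH] f cf x Ax.
  exact: (Ck_differentiable (cf 0)).
rewrite foldr_rcons; apply: IH => // k.
by have [_] := cf k.+1; exact.
Qed.

Lemma Ck_derive (V W : normedModType R) k (A : set V) (f : V -> W) v :
  Ck k.+1 A f -> Ck k A (fun x => 'D_v f x).
Proof. by case=> _; exact. Qed.

Lemma CkW (V W : normedModType R) k (A : set V) (f : V -> W) :
  Ck k.+1 A f -> Ck k A f.
Proof.
elim: k f => [|k IH] f [df cf]; split=> // v; exact: IH.
Qed.

Lemma sub_Ck (V W : normedModType R) k (A B : set V) (f : V -> W) :
  A `<=` B -> Ck k B f -> Ck k A f.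
Proof.
move=> AB; elim: k f => [|k IH] f [df cf]; first by split=> // x /AB/df.
split=> [x /AB/df//|v]; exact: (IH _ (cf v)).
Qed.

Lemma near_open (V : normedModType R) (A : set V) x :
  open A -> A x -> \near x, A x.
Proof. by move=> oA Ax; exact: open_nbhs_nbhs. Qed.

(** On an open set all derivatives are determined by the restriction. *)
Lemma eq_Ck (V W : normedModType R) k (A : set V) (f g : V -> W) :
  open A -> (forall x, A x -> f x = g x) -> Ck k A f -> Ck k A g.
Proof.
move=> oA; elim: k f g => [|k IH] f g fg [df cf].
  split=> // x Ax; apply: near_eq_differentiable (df _ Ax).
  exact: filterS fg (near_open oA Ax).
split=> [x Ax|v].
  apply: near_eq_differentiable (df _ Ax).
  exact: filterS fg (near_open oA Ax).
apply: IH (cf v) => x Ax; apply: near_eq_derive.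
exact: filterS fg (near_open oA Ax).
Qed.

Section Algebra.
Context {V : normedModType R} (A : set V) (oA : open A).

Lemma Ck_cst (W : normedModType R) k (c : W) : Ck k A (fun=> c).
Proof.
elim: k c => [|k IH] c; first by split=> // x _; exact: differentiable_cst.
split=> [x _|v]; first exact: differentiable_cst.
by under eq_fun do rewrite derive_cst.
Qed.

Lemma CkD (W : normedModType R) k (f g : V -> W) :
  Ck k A f -> Ck k A g -> Ck k A (fun x => f x + g x).
Proof.
elim: k f g => [|k IH] f g [df cf] [dg cg].
  by split=> // x Ax; apply: differentiableD; [exact: df|exact: dg].
split=> [x Ax|v]; first by apply: differentiableD; [exact: df|exact: dg].
apply: (eq_Ck oA _ (IH _ _ (cf v) (cg v))) => x Ax.
by rewrite [RHS]deriveD //; apply: diff_derivable; [exact: df|exact: dg].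
Qed.

Lemma CkM k (f g : V -> R) :
  Ck k A f -> Ck k A g -> Ck k A (fun x => f x * g x).
Proof.
elim: k f g => [|k IH] f g.
  move=> [df _] [dg _]; split=> // x Ax.
  by apply: differentiableM; [exact: df|exact: dg].
move=> cf cg; have [df cf'] := cf; have [dg cg'] := cg; split=> [x Ax|v].
  by apply: differentiableM; [exact: df|exact: dg].
have h := CkD (IH _ _ (cf' v) (CkW cg)) (IH _ _ (CkW cf) (cg' v)).
apply: (eq_Ck oA _ h) => x Ax.
by rewrite deriveMf; [|exact: df|exact: dg].
Qed.

Lemma Ck_sum (W : normedModType R) k (I : Type) (s : seq I) (f : I -> V -> W) :
  (forall i, Ck k A (f i)) -> Ck k A (fun x => \sum_(i <- s) f i x).
Proof.
move=> cf; elim: s => [|i s IH].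
  by under eq_fun do rewrite big_nil; exact: Ck_cst.
by under eq_fun do rewrite big_cons; exact: CkD.
Qed.

Lemma Ck_rowP k m (f : V -> 'rV[R]_m) :
  Ck k A f <-> forall j, Ck k A (fun x => f x 0 j).
Proof.
elim: k f => [|k IH] f.
  split=> [[df _] j|cf]; split=> // x Ax.
    by have /differentiable_mxP := df _ Ax; exact.
  apply/differentiable_mxP => i j; rewrite ord1.
  by have [] := cf j => + _; exact.
split=> [[df cf] j|cf].
  split=> [x Ax|v]; first by have /differentiable_mxP := df _ Ax; exact.
  have /IH/(_ j) := cf v; apply: eq_Ck => // x Ax.
  by rewrite derive_coord //; exact: df.
have df x : A x -> differentiable f x.
  move=> Ax; apply/differentiable_mxP => i j; rewrite ord1.
  by have [] := cf j => + _; exact.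
split=> // v; apply/IH => j; have [_ /(_ v)] := cf j.
apply: eq_Ck => // x Ax; rewrite derive_coord //; exact: df.
Qed.

Lemma Ck_comp1 k (B : set R) (f : V -> R) (F : R -> R) :
  (forall x, A x -> B (f x)) -> Ck k B F -> Ck k A f ->
  Ck k A (fun x => F (f x)).
Proof.
move=> AB; elim: k F => [|k IH] F.
  move=> [dF _] [df _]; split=> // x Ax.
  exact: (differentiable_comp (df _ Ax) (dF _ (AB _ Ax))).
move=> [dF cF] cf; have [df cf'] := cf; split=> [x Ax|v].
  exact: (differentiable_comp (df _ Ax) (dF _ (AB _ Ax))).
apply: (eq_Ck oA _ (CkM (cf' v) (IH _ (cF 1) (CkW cf)))) => x Ax.
by rewrite (derive_comp1 _ (df _ Ax) (dF _ (AB _ Ax))).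
Qed.

Lemma Ck_comp_row k m (B : set 'rV[R]_m) (f : V -> 'rV[R]_m)
    (F : 'rV[R]_m -> R) :
  (forall x, A x -> B (f x)) -> Ck k B F -> Ck k A f ->
  Ck k A (fun x => F (f x)).
Proof.
move=> AB; elim: k F => [|k IH] F.
  move=> [dF _] [df _]; split=> // x Ax.
  exact: (differentiable_comp (df _ Ax) (dF _ (AB _ Ax))).
move=> [dF cF] cf; have [df cf'] := cf; split=> [x Ax|v].
  exact: (differentiable_comp (df _ Ax) (dF _ (AB _ Ax))).
have h i : Ck k A (fun x => 'D_v (fun y => f y 0 i) x *
                            'D_(delta_mx 0 i) F (f x)).
  apply: CkM; last exact: (IH _ (cF _) (CkW cf)).
  by move/Ck_rowP : cf => /(_ i)[_]; exact.
apply: (eq_Ck oA _ (Ck_sum _ h)) => x Ax.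
by rewrite (derive_comp_row _ (df _ Ax) (dF _ (AB _ Ax))).
Qed.

Lemma CkZ k m (f : V -> R) (g : V -> 'rV[R]_m) :
  Ck k A f -> Ck k A g -> Ck k A (fun x => f x *: g x).
Proof.
move=> cf /Ck_rowP cg; apply/Ck_rowP => j; under eq_fun do rewrite mxE.
exact: CkM.
Qed.

End Algebra.

Lemma Ck_comp1_row (V : normedModType R) (A : set V) k m (B : set R)
    (f : V -> R) (F : R -> 'rV[R]_m) : open A -> open B ->
  (forall x, A x -> B (f x)) -> Ck k B F -> Ck k A f ->
  Ck k A (fun x => F (f x)).
Proof.
move=> oA oB AB cF cf; apply/Ck_rowP => // j.
apply: (Ck_comp1 oA (F := fun t => F t 0 j) AB) => //.
by move/(Ck_rowP oB) : cF; exact.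
Qed.

Lemma open_neq0 : open [set x : R | x != 0].
Proof. exact: open_neq. Qed.

(** The derivative of the inverse is polynomial in the inverse. *)
Lemma Ck_inv k : Ck k [set x : R | x != 0] (fun x => x^-1).
Proof.
elim: k => [|k IH]; first by split=> // x; exact: differentiable_Rinv.
split=> [x|v]; first exact: differentiable_Rinv.
have o := open_neq0.
have c1 : Ck k [set x : R | x != 0] (fun=> - v : R) by exact: Ck_cst.
have h := CkM o c1 (CkM o IH IH).
apply: (eq_Ck o _ h) => x x0.
rewrite deriveE; last exact: differentiable_Rinv.
by rewrite diff_Rinv // /GRing.scale /= expr2 invfM; ring.
Qed.

Lemma differentiable_sqrt (x : R) : 0 < x -> differentiable (@Num.sqrt R) x.
Proof. by move=> x0; apply/derivable1_diffP; have [] := is_derive1_sqrt x0. Qed.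

(** The derivative of the square root is a composite of the square root and the
    inverse. *)
Lemma Ck_sqrt k : Ck k [set x : R | 0 < x] (@Num.sqrt R).
Proof.
elim: k => [|k IH]; first by split=> // x; exact: differentiable_sqrt.
split=> [x|v]; first exact: differentiable_sqrt.
have o : open [set x : R | 0 < x] by exact: open_gt.
have h0 : Ck k [set x : R | 0 < x] (fun x => (2 * Num.sqrt x)^-1).
  apply: (Ck_comp1 o (B := [set x : R | x != 0])) (Ck_inv k) _ => [x /= x0|].
    by rewrite mulf_neq0 // gt_eqF // sqrtr_gt0.
  exact: (CkM o (Ck_cst _ _ _)).
have c1 : Ck k [set x : R | 0 < x] (fun=> v : R) by exact: Ck_cst.
apply: (eq_Ck o _ (CkM o c1 h0)) => x x0.
rewrite -(@derive_val _ _ _ _ _ _ _ (is_derive1_sqrt x0)).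
rewrite !deriveE; try exact: differentiable_sqrt.
by rewrite -[in RHS](mulr1 v) [RHS]linearZ.
Qed.

End SmoothCalculus.

(** * Symmetry of second derivatives *)

Section MixedDerivatives.
Context {R : realType} {V : normedModType R}.
Implicit Types (f : V -> R) (x y v w : V).

Lemma derive_translate (W : normedModType R) (f : V -> W) a y v :
  'D_v (fun z => f (a + z)) y = 'D_v f (a + y).
Proof.
rewrite /derive; set F := (fun _ : R => _); set G := (fun _ : R => _).
by suff -> : F = G by []; apply/funext => h; rewrite /F /G /= addrCA.
Qed.

Lemma differentiable_translate (W : normedModType R) (f : V -> W) a y :
  differentiable f (a + y) -> differentiable (fun z => f (a + z)) y.
Proof.
move=> df; apply: (@differentiable_comp _ _ _ _ (fun z => a + z) f) => //.
Qed.

Lemma line_MVT f y v (h : R) : 0 <= h ->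
  (forall s : R, 0 <= s <= h -> differentiable f (s *: v + y)) ->
  exists2 c, 0 <= c <= h & f (h *: v + y) - f y = h * 'D_v f (c *: v + y).
Proof.
move=> h0 df.
pose F (s : R) := f (s *: v + y).
have dl (s : R) : differentiable (fun s : R => s *: v + y) s.
  apply: differentiableD; last exact: differentiable_cst.
  by apply: differentiableZl; exact: ex_diff.
have dF (s : R) : 0 <= s <= h -> is_derive s 1 F ('D_v f (s *: v + y)).
  move=> sh; have dfs := df s sh.
  have dFs : differentiable F s by exact: (differentiable_comp (dl s) dfs).
  apply: DeriveDef; first exact: diff_derivable.
  rewrite deriveE // diff_comp //= [RHS]deriveE //; congr ('d f _ _).
  rewrite -deriveE // [LHS]deriveD; last 2 first.
  - apply: diff_derivable; apply: differentiableZl; exact: ex_diff.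
  - exact: derivable_cst.
  rewrite derive_cst addr0 deriveE; last first.
    by apply: differentiableZl; exact: ex_diff.
  rewrite diffZl; last exact: ex_diff.
  by rewrite -deriveE ?derive_id ?scale1r //; exact: ex_diff.
have [||c] := @MVT_segment _ F (fun s => 'D_v f (s *: v + y)) 0 h h0.
- by move=> s; rewrite in_itv /= => /andP[s0 sh]; apply: dF; rewrite !ltW.
- apply: derivable_within_continuous => s; rewrite in_itv /= => sh.
  by have [] := dF s sh.
rewrite in_itv /= /F scale0r add0r subr0 => ch ->.
by exists c => //; rewrite mulrC.
Qed.

(** The second difference of [f] along [v] and [w], computed by differentiating
    first along [v]; the left-hand side is symmetric in [v] and [w]. *)
Lemma second_difference f x v w (h : R) (U : set V) : 0 <= h ->
  Ck 1 U f ->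
  (forall s t : R, 0 <= s <= h -> 0 <= t <= h -> U (t *: w + (s *: v + x))) ->
  exists s t : R, [/\ 0 <= s <= h, 0 <= t <= h &
    f (h *: w + (h *: v + x)) - f (h *: v + x) - (f (h *: w + x) - f x) =
    h * (h * 'D_w (fun y => 'D_v f y) (t *: w + (s *: v + x)))].
Proof.
move=> h0 cf hU.
have hh : 0 <= h <= h by rewrite lexx h0.
have h00 : 0 <= (0 : R) <= h by rewrite lexx h0.
have df (s t : R) : 0 <= s <= h -> 0 <= t <= h ->
    differentiable f (t *: w + (s *: v + x)).
  by move=> sh th; apply: (Ck_differentiable cf); exact: hU.
have df0 (s : R) : 0 <= s <= h -> differentiable f (s *: v + x).
  by move=> sh; have := df s 0 sh h00; rewrite scale0r add0r.
have dfw (s : R) : 0 <= s <= h -> differentiable (fun y => f (h *: w + y)) (s *: v + x).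
  by move=> sh; apply: differentiable_translate; exact: df.
have [|s sh] := @line_MVT (fun y => f (h *: w + y) - f y) x v h h0.
  by move=> s sh; apply: differentiableB; [exact: dfw|exact: df0].
have -> : 'D_v (fun y => f (h *: w + y) - f y) (s *: v + x) =
    'D_v f (h *: w + (s *: v + x)) - 'D_v f (s *: v + x).
  rewrite -[in X in _ = X - _]derive_translate [LHS]deriveB //.
    by apply: diff_derivable; exact: dfw.
  by apply: diff_derivable; exact: df0.
move=> E.
have [|t th E2] := @line_MVT (fun y => 'D_v f y) (s *: v + x) w h h0.
  move=> t th; exact: (Ck_differentiable (Ck_derive v cf) (hU _ _ sh th)).
by exists s, t; split => //; rewrite E E2.
Qed.

(** Symmetry of second derivatives: both mixed derivatives at [x] are limits of
    the same second difference quotient. *)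
Lemma derive_comm f x v w (U : set V) : open U -> U x -> Ck 2 U f ->
  'D_w (fun y => 'D_v f y) x = 'D_v (fun y => 'D_w f y) x.
Proof.
move=> oU Ux cf; apply/eqP/negPn/negP => neq.
set A := 'D_w _ x in neq; set B := 'D_v _ x in neq.
have e0 : 0 < `|A - B| / 2 by rewrite divr_gt0 // normr_gt0 subr_eq0.
have cts a b : {for x, continuous (fun y => 'D_a (fun z => 'D_b f z) y)}.
  apply: differentiable_continuous.
  exact: (Ck_differentiable (Ck_derive a (Ck_derive b cf)) Ux).
have /cvgrPdist_lt/(_ _ e0) nA := cts w v.
have /cvgrPdist_lt/(_ _ e0) nB := cts v w.
have /nbhs_ballP[d /= d0 Hd] :
    \near x, [/\ U x, `|A - 'D_w (fun y => 'D_v f y) x| < `|A - B| / 2 &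
                 `|B - 'D_v (fun y => 'D_w f y) x| < `|A - B| / 2].
  apply: filterS3 (near_open oU Ux) nA nB => y Uy Ay By.
  by split; [exact: Uy|exact: Ay|exact: By].
(* The parallelogram with sides [h *: v] and [h *: w] stays in the ball of
   radius [d]; the summand 1 makes [m] positive and the bound strict. *)
set m := `|v| + `|w| + 1.
have m0 : 0 < m by rewrite ltr_wpDl // addr_ge0.
pose h := d / m.
have h0 : 0 < h by rewrite divr_gt0.
have inball (s t : R) a b : `|a| + `|b| < m -> 0 <= s <= h -> 0 <= t <= h ->
    ball x d (t *: b + (s *: a + x)).
  move=> ab /andP[s0 sh] /andP[t0 th].
  rewrite -ball_normE /= [t *: b + (_ + _)]addrA opprD addrCA subrr addr0 normrN.
  rewrite (le_lt_trans (ler_normD _ _)) // !normrZ !ger0_norm //.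
  have -> : d = h * m by rewrite divfK ?gt_eqF.
  rewrite (@le_lt_trans _ _ (h * (`|a| + `|b|))) ?ltr_pM2l //.
  by rewrite mulrDr addrC lerD // ler_wpM2r.
have vw : `|v| + `|w| < m by rewrite ltrDl.
have wv : `|w| + `|v| < m by rewrite addrC.
have [s [t [sh th E1]]] : exists s t : R, [/\ 0 <= s <= h, 0 <= t <= h &
    f (h *: w + (h *: v + x)) - f (h *: v + x) - (f (h *: w + x) - f x) =
    h * (h * 'D_w (fun y => 'D_v f y) (t *: w + (s *: v + x)))].
  apply: (second_difference (ltW h0) (CkW cf)) => s t sh th.
  by have [] := Hd _ (inball s t v w vw sh th).
have [s' [t' [sh' th' E2]]] : exists s t : R, [/\ 0 <= s <= h, 0 <= t <= h &
    f (h *: v + (h *: w + x)) - f (h *: w + x) - (f (h *: v + x) - f x) =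
    h * (h * 'D_v (fun y => 'D_w f y) (t *: v + (s *: w + x)))].
  apply: (second_difference (ltW h0) (CkW cf)) => s' t' sh' th'.
  by have [] := Hd _ (inball s' t' w v wv sh' th').
have [_ HA _] := Hd _ (inball s t v w vw sh th).
have [_ _ HB] := Hd _ (inball s' t' w v wv sh' th').
move: HA HB E1 E2.
set y := 'D_w _ (_ + _); set y' := 'D_v _ (_ + _) => HA HB E1 E2.
have hn : h != 0 by rewrite gt_eqF.
have S : f (h *: w + (h *: v + x)) - f (h *: v + x) - (f (h *: w + x) - f x) =
         f (h *: v + (h *: w + x)) - f (h *: w + x) - (f (h *: v + x) - f x).
  by rewrite [h *: v + (h *: w + x)]addrCA; ring.
have /(mulfI hn)/(mulfI hn) yy' := etrans (esym E1) (etrans S E2).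
rewrite -yy' in HB.
have := ler_normB (A - y) (B - y).
rewrite opprB addrA subrK => /le_lt_trans/(_ (ltrD HA HB)).
by rewrite -splitr ltxx.
Qed.

End MixedDerivatives.

(** * The Minkowski product *)

Section MinkowskiAlgebra.
Context {R : realType} {n : nat}.
Implicit Types (x y z : 'rV[R]_n.+1).

Definition mink_sign (i : 'I_n.+1) : R := if i == ord_max then -1 else 1.

Lemma minkE x y : mink x y = \sum_i mink_sign i * (x 0 i * y 0 i).
Proof.
rewrite (bigD1_ord ord_max) //= /mink_sign eqxx mulN1r addrC /mink.
congr (_ - _); apply: eq_bigr => i _.
by rewrite eq_sym (negPf (neq_lift _ _)) mul1r.
Qed.

Lemma minkC x y : mink x y = mink y x.
Proof. by rewrite !minkE; apply: eq_bigr => i _; rewrite (mulrC (x 0 i)). Qed.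

Lemma minkDl x y z : mink (x + y) z = mink x z + mink y z.
Proof.
rewrite !minkE -big_split /=; apply: eq_bigr => i _.
by rewrite !mxE; ring.
Qed.

Lemma minkZl (a : R) x y : mink (a *: x) y = a * mink x y.
Proof.
by rewrite !minkE mulr_sumr; apply: eq_bigr => i _; rewrite !mxE; ring.
Qed.

Lemma minkDr x y z : mink x (y + z) = mink x y + mink x z.
Proof. by rewrite minkC minkDl !(minkC x). Qed.

Lemma minkZr (a : R) x y : mink x (a *: y) = a * mink x y.
Proof. by rewrite minkC minkZl minkC. Qed.

Lemma minkNl x y : mink (- x) y = - mink x y.
Proof. by rewrite -scaleN1r minkZl mulN1r. Qed.

Lemma minkNr x y : mink x (- y) = - mink x y.
Proof. by rewrite minkC minkNl minkC. Qed.

Lemma mink_sqrB x y :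
  mink (x - y) (x - y) = mink x x - 2 * mink x y + mink y y.
Proof. by rewrite minkDl !minkDr !minkNl !minkNr (minkC y x); ring. Qed.

Lemma mink0l y : mink 0 y = 0.
Proof. by rewrite -(scale0r (0 : 'rV_n.+1)) minkZl mul0r. Qed.

Lemma mink_suml m (c : 'I_m -> 'rV[R]_n.+1) y :
  mink (\sum_i c i) y = \sum_i mink (c i) y.
Proof.
elim/big_ind2 : _ => [|a b a' b' <- <-|//]; first exact: mink0l.
exact: minkDl.
Qed.

Lemma mink_sumr m x (c : 'I_m -> 'rV[R]_n.+1) :
  mink x (\sum_i c i) = \sum_i mink x (c i).
Proof. by rewrite minkC mink_suml; apply: eq_bigr => i _; rewrite minkC. Qed.

Lemma mink_delta x i : mink x (delta_mx 0 i) = mink_sign i * x 0 i.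
Proof.
rewrite minkE (bigD1 i) //= mxE !eqxx mulr1 big1 ?addr0 // => j ji.
by rewrite mxE (negPf ji) andbF !mulr0.
Qed.

Lemma mink_sign_neq0 i : mink_sign i != 0.
Proof. by rewrite /mink_sign; case: ifP; rewrite ?oppr_eq0 oner_neq0. Qed.

Lemma mink_nondeg x : (forall y, mink x y = 0) -> x = 0.
Proof.
move=> x0; apply/rowP => i; have /eqP := x0 (delta_mx 0 i).
by rewrite mink_delta mulf_eq0 (negPf (mink_sign_neq0 i)) /= mxE => /eqP.
Qed.

(** The orthogonal of a nonzero vector has dimension [n], so [n] independent
    vectors orthogonal to it span it. *)
Lemma mink_orthogonal_span (A : 'M[R]_(n, n.+1)) x y :
  row_free A -> x != 0 -> (forall i, mink x (row i A) = 0) -> mink x y = 0 ->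
  exists a : 'rV[R]_n, y = a *m A.
Proof.
move=> fA x0 xA xy.
pose c : 'cV[R]_n.+1 := \col_i (mink_sign i * x 0 i).
have cE z : z *m c = (mink x z)%:M.
  apply/matrixP => i j; rewrite !ord1 !mxE eqxx mulr1n minkE.
  by apply: eq_bigr => k _; rewrite !mxE; ring.
have c0 : c != 0.
  apply: contra x0 => /eqP c0; apply/eqP/rowP => i.
  have /eqP := congr1 (fun M : 'cV[R]_n.+1 => M i 0) c0.
  by rewrite !mxE mulf_eq0 (negPf (mink_sign_neq0 i)) /= => /eqP.
have rc : \rank c = 1%N.
  apply/eqP; rewrite eqn_leq rank_leq_col lt0n mxrank_eq0; exact: c0.
have AK : (A <= kermx c)%MS.
  apply/row_subP => i; apply/sub_kermxP; rewrite cE xA.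
  by apply/matrixP => k l; rewrite !mxE mul0rn.
have KA : (kermx c <= A)%MS.
  rewrite -(geq_leqif (mxrank_leqif_sup AK)) mxrank_ker rc subn1 /=.
  by move: fA; rewrite /row_free => /eqP ->.
have yK : (y <= kermx c)%MS.
  by apply/sub_kermxP; rewrite cE xy; apply/matrixP => k l; rewrite !mxE mul0rn.
by have /submxP[a ->] := submx_trans yK KA; exists a.
Qed.

End MinkowskiAlgebra.

Section MinkowskiCalculus.
Context {R : realType} {n : nat} {V : normedModType R}.
Implicit Types (f g : V -> 'rV[R]_n.+1).

Lemma differentiable_entry m p (F : V -> 'M[R]_(m, p)) x i j :
  differentiable F x -> differentiable (fun y => F y i j) x.
Proof. by move=> /differentiable_mxP; exact. Qed.

Lemma differentiableMf (f g : V -> R) x :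
  differentiable f x -> differentiable g x ->
  differentiable (fun y => f y * g y) x.
Proof. exact: differentiableM. Qed.

Lemma differentiable_mink f g x : differentiable f x -> differentiable g x ->
  differentiable (fun y => mink (f y) (g y)) x.
Proof.
move=> df dg; under eq_fun do rewrite minkE.
apply: differentiable_bigsum => i; apply: differentiableMf; first exact: differentiable_cst.
by apply: differentiableMf; exact: differentiable_entry.
Qed.

Lemma derive_mink f g x v : differentiable f x -> differentiable g x ->
  'D_v (fun y => mink (f y) (g y)) x =
  mink ('D_v f x) (g x) + mink (f x) ('D_v g x).
Proof.
move=> df dg; under eq_fun do rewrite minkE.
have dfi i : differentiable (fun y => f y 0 i) x by exact: differentiable_entry.
have dgi i : differentiable (fun y => g y 0 i) x by exact: differentiable_entry.
have dfg i : differentiable (fun y => f y 0 i * g y 0 i) x.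
  exact: differentiableMf.
rewrite derive_bigsum => [|i]; last first.
  by apply: differentiableMf => //; exact: differentiable_cst.
rewrite !minkE -big_split /=; apply: eq_bigr => i _.
rewrite deriveMf //.
by rewrite derive_cst mul0r add0r deriveMf // !derive_coord // mulrDr.
Qed.

Lemma Ck_mink (A : set V) k f g : open A -> Ck k A f -> Ck k A g ->
  Ck k A (fun y => mink (f y) (g y)).
Proof.
move=> oA cf cg; under eq_fun do rewrite minkE.
apply: Ck_sum => // i; apply: CkM => //; first exact: Ck_cst.
by apply: CkM => //; [move/Ck_rowP : cf|move/Ck_rowP : cg]; exact.
Qed.

Lemma differentiable_det m (F : V -> 'M[R]_m) x :
  differentiable F x -> differentiable (fun y => \det (F y)) x.
Proof.
move=> dF; apply: differentiable_bigsum => s.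
apply: differentiableMf; first exact: differentiable_cst.
elim: (index_enum _) => [|i l IH].
  by under eq_fun do rewrite big_nil; exact: differentiable_cst.
under eq_fun do rewrite big_cons.
by apply: differentiableMf => //; exact: differentiable_entry.
Qed.

(** By Cramer's rule, the inverse is a rational function of the entries. *)
Lemma differentiable_invmx m (F : V -> 'M[R]_m) x i j :
  (\near x, F x \in unitmx) ->
  differentiable F x -> differentiable (fun y => invmx (F y) i j) x.
Proof.
move=> uF dF.
have dcof : differentiable (fun y => cofactor (F y) j i) x.
  apply: differentiableMf; first exact: differentiable_cst.
  apply: differentiable_det; apply/differentiable_mxP => k l.
  under eq_fun do rewrite !mxE.
  exact: differentiable_entry.
have ddet : differentiable (fun y => (\det (F y))^-1) x.
  apply: differentiableV; first exact: differentiable_det.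
  by have := nbhs_singleton uF; rewrite unitmxE unitfE.
apply: near_eq_differentiable (differentiableMf ddet dcof).
apply: filterS uF => y uy.
by rewrite /invmx uy !mxE.
Qed.

End MinkowskiCalculus.

(** * The Gauss equation for a time-like unit normal *)

Section Gauss.
Context {R : realType} {n : nat}.
Variables (U : set 'rV[R]_n) (X N : 'rV[R]_n -> 'rV[R]_n.+1).

Definition frame (u : 'rV[R]_n) : 'M[R]_(n, n.+1) :=
  \matrix_i 'D_(delta_mx 0 i) X u.

Lemma derive_frame u a : differentiable X u -> 'D_a X u = a *m frame u.
Proof.
move=> dX; rewrite derive_rowE // mulmx_sum_row.
by apply: eq_bigr => i _; rewrite rowK.
Qed.

Hypotheses (oU : open U) (cX : Ck 3 U X).
Hypotheses (dN : forall u, U u -> differentiable N u)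
  (NN : forall u, U u -> mink (N u) (N u) = -1)
  (NX : forall u i, U u -> mink (N u) ('D_(delta_mx 0 i) X u) = 0)
  (fX : forall u, U u -> row_free (frame u)).

Local Notation d1 i := (fun u => 'D_(delta_mx 0 i) X u).
Local Notation d2 i j := (fun u => 'D_(delta_mx 0 i) (d1 j) u).
Local Notation d3 i j k := (fun u => 'D_(delta_mx 0 i) (d2 j k) u).
Local Notation g := (induced_metric X).

Let C1 i : Ck 2 U (d1 i). Proof. exact: Ck_derive. Qed.
Let C2 i j : Ck 1 U (d2 i j). Proof. exact: Ck_derive (C1 j). Qed.
Let D1 i u : U u -> differentiable (d1 i) u.
Proof. exact: Ck_differentiable (C1 i). Qed.
Let D2 i j u : U u -> differentiable (d2 i j) u.
Proof. exact: Ck_differentiable (C2 i j). Qed.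

Lemma derive_comm_row (Y : 'rV[R]_n -> 'rV[R]_n.+1) u v w :
  Ck 2 U Y -> U u ->
  'D_v (fun y => 'D_w Y y) u = 'D_w (fun y => 'D_v Y y) u.
Proof.
move=> cY Uu; apply/rowP => k.
have dY a : Ck 1 U (fun y => 'D_a Y y) by exact: Ck_derive.
have DY a := Ck_differentiable (dY a) Uu.
have E a b : 'D_b (fun y => 'D_a Y y 0 k) u =
             'D_b (fun y => 'D_a (fun z => Y z 0 k) y) u.
  apply: near_eq_derive; apply: filterS (near_open oU Uu) => y Uy.
  by apply: derive_coord; exact: (Ck_differentiable cY).
have cYk : Ck 2 U (fun z => Y z 0 k) by move/Ck_rowP : cY; exact.
have S := derive_comm w v oU Uu cYk.
apply: (etrans (derive_coord v 0 k (DY w))).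
apply: (etrans _ (esym (derive_coord w 0 k (DY v)))).
exact: (etrans (E w v) (etrans S (esym (E v w)))).
Qed.

Let d2C i j u : U u -> 'D_(delta_mx 0 i) (d1 j) u = 'D_(delta_mx 0 j) (d1 i) u.
Proof. by move=> Uu; apply: derive_comm_row => //; exact: CkW. Qed.

Let d3C i j k u : U u ->
  'D_(delta_mx 0 i) (d2 j k) u = 'D_(delta_mx 0 j) (d2 i k) u.
Proof. by move=> Uu; exact: derive_comm_row. Qed.

Definition second_form (u : 'rV[R]_n) i j : R :=
  mink ('D_(delta_mx 0 i) N u) ('D_(delta_mx 0 j) X u).
Local Notation h := second_form.

(** Differentiate the orthogonality of [N] to the coordinate vectors. *)
Let h_normal u i j : U u -> mink (N u) ('D_(delta_mx 0 i) (d1 j) u) = - h u i j.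
Proof.
move=> Uu.
have E0 : 'D_(delta_mx 0 i) (fun v => mink (N v) (d1 j v)) u = 0.
  rewrite (@near_eq_derive _ _ _ _ (fun=> 0)) ?derive_cst //.
  by apply: filterS (near_open oU Uu) => y Uy; exact: NX.
have E := derive_mink (delta_mx 0 i) (dN Uu) (D1 j Uu).
by apply/eqP; rewrite -addr_eq0 addrC /h -E E0.
Qed.

(** The coordinate vectors and the normal span the whole space. *)
Let mink_frame_normal u y : U u ->
  (forall i, mink y ('D_(delta_mx 0 i) X u) = 0) -> mink y (N u) = 0 -> y = 0.
Proof.
move=> Uu yX yN; apply: mink_nondeg => v.
have N0 : N u != 0.
  apply/eqP => N0; have := NN Uu; rewrite N0 mink0l => /eqP.
  by rewrite eq_sym oppr_eq0 oner_eq0.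
have [||a va] := @mink_orthogonal_span _ _ (frame u) (N u)
    (v + mink v (N u) *: N u) (fX Uu) N0.
- by move=> i; rewrite rowK NX.
- by rewrite minkDr minkZr NN // mulrN1 minkC subrr.
have : mink y (v + mink v (N u) *: N u) = 0.
  rewrite va mulmx_sum_row mink_sumr big1 // => i _.
  by rewrite minkZr rowK yX mulr0.
by rewrite minkDr minkZr yN mulr0 addr0.
Qed.

Let metricE u i j : g u i j = mink ('D_(delta_mx 0 i) X u) ('D_(delta_mx 0 j) X u).
Proof. by rewrite mxE. Qed.

Lemma induced_metric_unit u : U u -> g u \in unitmx.
Proof.
move=> Uu; rewrite -row_free_unit; apply/inj_row_free => a ag.
have aF : a *m frame u = 0.
  apply: (mink_frame_normal Uu) => [j|].
    have /rowP/(_ j) := ag; rewrite !mxE => <-.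
    rewrite mulmx_sum_row mink_suml; apply: eq_bigr => i _.
    by rewrite minkZl rowK metricE.
  rewrite mulmx_sum_row mink_suml big1 // => i _.
  by rewrite minkZl rowK minkC NX // mulr0.
by apply: (row_free_inj (fX Uu)); rewrite aF mul0mx.
Qed.

Let partial_g u l i j : U u -> partial l (fun v => g v i j) u =
  mink (d2 l i u) (d1 j u) + mink (d1 i u) (d2 l j u).
Proof.
move=> Uu; rewrite /partial -(derive_mink (delta_mx 0 l) (D1 i Uu) (D1 j Uu)).
by under eq_fun do rewrite metricE.
Qed.

(** The Koszul formula in coordinates: [x1] are first and [x2] second
    derivatives. *)
Let koszul (x1 : 'I_n -> 'rV[R]_n.+1) (x2 : 'I_n -> 'I_n -> 'rV[R]_n.+1) i j l :
  (forall i j, x2 i j = x2 j i) ->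
  2^-1 * ((mink (x2 i j) (x1 l) + mink (x1 j) (x2 i l)) +
          (mink (x2 j i) (x1 l) + mink (x1 i) (x2 j l)) -
          (mink (x2 l i) (x1 j) + mink (x1 i) (x2 l j))) =
  mink (x2 i j) (x1 l).
Proof.
move=> x2C; rewrite (x2C l i) (x2C l j) (x2C j i) (minkC (x2 i l)); by field.
Qed.

Let christoffelE u k i j : U u ->
  christoffel g k i j u = \sum_l invmx (g u) k l * mink (d2 i j u) (d1 l u).
Proof.
move=> Uu; rewrite /christoffel mulr_sumr; apply: eq_bigr => l _.
rewrite !partial_g // mulrCA; congr (_ * _).
exact: (@koszul (fun i => d1 i u) (fun i j => d2 i j u) i j l
  (fun i j => d2C i j Uu)).
Qed.

Let christoffel_metric u i j q : U u ->
  \sum_l christoffel g l i j u * g u l q = mink (d2 i j u) (d1 q u).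
Proof.
move=> Uu; pose c : 'rV[R]_n := \row_l mink (d2 i j u) (d1 l u).
have gC : (g u)^T = g u.
  by apply/matrixP => k l; rewrite mxE !metricE minkC.
have giC : (invmx (g u))^T = invmx (g u) by rewrite trmx_inv gC.
have -> : mink (d2 i j u) (d1 q u) = (c *m (invmx (g u) *m g u)) 0 q.
  by rewrite mulVmx ?induced_metric_unit // mulmx1 mxE.
rewrite mulmxA [RHS]mxE; apply: eq_bigr => l _; congr (_ * _).
rewrite christoffelE // mxE; apply: eq_bigr => m _.
by rewrite -[in LHS]giC !mxE mulrC.
Qed.

(** The second derivatives split into a tangential part, with the Christoffel
    symbols as coordinates, and a normal part. *)
Lemma gauss_formula u i j : U u ->
  'D_(delta_mx 0 i) (d1 j) u =
  \sum_l christoffel g l i j u *: 'D_(delta_mx 0 l) X u + h u i j *: N u.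
Proof.
move=> Uu; apply/eqP; rewrite -subr_eq0; apply/eqP.
apply: (mink_frame_normal Uu) => [q|].
  rewrite minkDl minkNl minkDl minkZl NX // mulr0 addr0 mink_suml.
  under eq_bigr do rewrite minkZl -metricE.
  by rewrite christoffel_metric // subrr.
rewrite minkDl minkNl minkDl minkZl NN // mulrN1 mink_suml.
under eq_bigr do rewrite minkZl minkC NX // mulr0.
by rewrite big1 // minkC h_normal // add0r subrr.
Qed.

Let dchristoffel u k i j : U u -> differentiable (christoffel g k i j) u.
Proof.
move=> Uu.
have dgu : differentiable g u.
  apply/differentiable_mxP => a b; under eq_fun do rewrite metricE.
  by apply: differentiable_mink; exact: D1.
apply: (@near_eq_differentiable _ _ _
  (fun u => \sum_l invmx (g u) k l * mink (d2 i j u) (d1 l u))).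
  by apply: filterS (near_open oU Uu) => y Uy; rewrite christoffelE.
apply: differentiable_bigsum => l; apply: differentiableMf.
  apply: differentiable_invmx => //.
  by apply: filterS (near_open oU Uu) => y Uy; exact: induced_metric_unit.
by apply: differentiable_mink; [exact: D2|exact: D1].
Qed.

(** Differentiate the relation of [christoffel_metric] and eliminate the second
    derivatives by [gauss_formula]. This expresses the Christoffel part of the
    curvature through third derivatives of [X] and the second fundamental
    form. *)
Let partial_christoffel u i j k q : U u ->
  \sum_l (partial i (christoffel g l j k) u +
          \sum_m christoffel g m j k u * christoffel g l i m u) * g u l q =
  mink (d3 i j k u) (d1 q u) - h u j k * h u i q.
Proof.
move=> Uu.
have E : partial i (fun v => \sum_l christoffel g l j k v * g v l q) u =
         mink (d3 i j k u) (d1 q u) + mink (d2 j k u) (d2 i q u).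
  rewrite /partial -(derive_mink (delta_mx 0 i) (D2 j k Uu) (D1 q Uu)).
  apply: near_eq_derive; apply: filterS (near_open oU Uu) => v Uv.
  by rewrite christoffel_metric.
have dg l : differentiable (fun v => g v l q) u.
  under eq_fun do rewrite metricE.
  by apply: differentiable_mink; exact: D1.
have E2 : partial i (fun v => \sum_l christoffel g l j k v * g v l q) u =
  \sum_l partial i (christoffel g l j k) u * g u l q +
  (\sum_l christoffel g l j k u * mink (d2 i l u) (d1 q u) +
   \sum_l christoffel g l j k u * mink (d1 l u) (d2 i q u)).
  rewrite /partial derive_bigsum => [|l]; last first.
    by apply: differentiableMf => //; exact: dchristoffel.
  rewrite -!big_split /=; apply: eq_bigr => l _.
  rewrite (deriveMf _ (dchristoffel _ _ _ Uu) (dg l)) -mulrDr.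
  by congr (_ + _ * _); exact: partial_g.
have E3 : mink (d2 j k u) (d2 i q u) =
  \sum_l christoffel g l j k u * mink (d1 l u) (d2 i q u) - h u j k * h u i q.
  rewrite [d2 j k u]gauss_formula // minkDl minkZl h_normal // mulrN mink_suml.
  by under eq_bigr do rewrite minkZl.
have E4 : \sum_l (\sum_m christoffel g m j k u * christoffel g l i m u) * g u l q =
  \sum_l christoffel g l j k u * mink (d2 i l u) (d1 q u).
  under eq_bigr do rewrite mulr_suml.
  rewrite exchange_big /=; apply: eq_bigr => m _.
  by rewrite -christoffel_metric // mulr_sumr; apply: eq_bigr => l _; rewrite mulrA.
have aux (p A B C M D H : R) :
  p = M + D -> p = A + (B + C) -> D = C - H -> A + B = M - H by lra.
under eq_bigr do rewrite mulrDl.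
rewrite big_split /=.
apply: etrans (congr1 (+%R _) E4) _.
exact: aux E E2 E3.
Qed.

(** Antisymmetrizing in [i] and [j] cancels the third derivatives of [X]. *)
Lemma gauss_riemann_coef u i j k q : U u ->
  \sum_l riemann_coef g i j k l u * g u l q = h u i k * h u j q - h u j k * h u i q.
Proof.
move=> Uu.
have E l : riemann_coef g i j k l u =
  (partial i (christoffel g l j k) u +
     \sum_m christoffel g m j k u * christoffel g l i m u) -
  (partial j (christoffel g l i k) u +
     \sum_m christoffel g m i k u * christoffel g l j m u).
  by rewrite /riemann_coef sumrB opprD addrACA.
under eq_bigr do rewrite E mulrBl.
have aux (a b c d : R) : a = b -> a - c - (b - d) = d - c by move=> ->; ring.
rewrite sumrB !partial_christoffel //; apply: aux.
exact: (congr1 (mink^~ _) (d3C i j k Uu)).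
Qed.

Let second_form_bilin u a b : U u ->
  mink ('D_a N u) ('D_b X u) = \sum_i \sum_j a 0 i * b 0 j * h u i j.
Proof.
move=> Uu; rewrite (derive_rowE a (dN Uu)) (derive_rowE b (Ck_differentiable cX Uu)).
rewrite mink_suml; apply: eq_bigr => i _; rewrite mink_sumr.
by apply: eq_bigr => j _; rewrite minkZl minkZr /h; ring.
Qed.

(** The sign is opposite to the Euclidean one because [N] is time-like. *)
Lemma gauss_equation u a b : U u ->
  metric_form g u (riemann g u a b b) a =
  mink ('D_a N u) ('D_b X u) * mink ('D_b N u) ('D_a X u) -
  mink ('D_b N u) ('D_b X u) * mink ('D_a N u) ('D_a X u).
Proof.
move=> Uu.
have -> : metric_form g u (riemann g u a b b) a =
    \sum_i \sum_j \sum_k \sum_q a 0 i * b 0 j * b 0 k * a 0 q *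
      (\sum_l riemann_coef g i j k l u * g u l q).
  rewrite /metric_form /riemann exchange_big /=.
  under eq_bigr => q _.
    under eq_bigr => l _.
      rewrite mxE mulr_sumr mulr_suml.
      under eq_bigr => i _.
        rewrite mulr_sumr mulr_suml.
        under eq_bigr => j _ do rewrite mulr_sumr mulr_suml.
        over.
      over.
    rewrite exchange_big /=.
    under eq_bigr => i _.
      rewrite exchange_big /=.
      under eq_bigr => j _ do rewrite exchange_big /=.
      over.
    over.
  rewrite exchange_big /=; apply: eq_bigr => i _.
  rewrite exchange_big /=; apply: eq_bigr => j _.
  rewrite exchange_big /=; apply: eq_bigr => k _.
  apply: eq_bigr => q _; rewrite mulr_sumr; apply: eq_bigr => l _; ring.
under eq_bigr => i _ do under eq_bigr => j _ do under eq_bigr => k _ do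
  under eq_bigr => q _ do rewrite gauss_riemann_coef // mulrBr.
under eq_bigr => i _ do under eq_bigr => j _ do under eq_bigr => k _ do
  rewrite sumrB.
under eq_bigr => i _ do under eq_bigr => j _ do rewrite sumrB.
under eq_bigr => i _ do rewrite sumrB.
rewrite sumrB !second_form_bilin //; move: (h u) => H; congr (_ - _).
  rewrite big_distrl /=; apply: eq_bigr => i _.
  rewrite exchange_big /= big_distrl /=; apply: eq_bigr => k _.
  rewrite big_distrr /=; apply: eq_bigr => j _.
  by rewrite big_distrr /=; apply: eq_bigr => q _; ring.
rewrite [RHS]mulrC big_distrl /=; apply: eq_bigr => i _.
under eq_bigr do rewrite exchange_big /=.
rewrite exchange_big /= big_distrl /=; apply: eq_bigr => q _.
rewrite big_distrr /=; apply: eq_bigr => j _.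
by rewrite big_distrr /=; apply: eq_bigr => k _; ring.
Qed.

End Gauss.

(** * Spheres of codimension two *)

Section SphereSections.
Context {R : realType} {n : nat}.
Implicit Types (x y : 'rV[R]_n.+1).

Lemma mink_orthogonal_exists k (v : 'I_k -> 'rV[R]_n.+1) : (k < n.+1)%N ->
  exists2 f : 'rV[R]_n.+1, f != 0 & forall i, mink (v i) f = 0.
Proof.
move=> kn; pose B : 'M[R]_(n.+1, k) := \matrix_(i, j) (mink_sign i * v j 0 i).
have : kermx B != 0.
  rewrite -mxrank_eq0 mxrank_ker subn_eq0 -ltnNge.
  exact: leq_ltn_trans (rank_leq_col B) kn.
case/rowV0Pn => f /sub_kermxP fB f0; exists f => // j.
have /rowP/(_ j) := fB; rewrite !mxE => <-; rewrite minkE.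
by apply: eq_bigr => i _; rewrite mxE; ring.
Qed.

Lemma mink_gt0_spatial x : x != 0 -> x 0 ord_max = 0 -> 0 < mink x x.
Proof.
move=> x0 xt; rewrite /mink xt mulr0 subr0 lt_neqAle; apply/andP; split; last first.
  by apply: sumr_ge0 => i _; rewrite -expr2 sqr_ge0.
apply: contra x0 => /eqP /esym sx; apply/eqP/rowP => i; rewrite mxE.
have [->//|im] := eqVneq i ord_max.
have [j ->] : exists j, i = lift ord_max j.
  by case: (unliftP ord_max i) im => [j ->|->]; [exists j|rewrite eqxx].
apply/eqP; rewrite -sqrf_eq0 expr2; apply/eqP.
by apply: (psumr_eq0P _ sx) => // k _; rewrite -expr2 sqr_ge0.
Qed.

Let dot x y : R := \sum_i x 0 i * y 0 i.
Let flip x : 'rV[R]_n.+1 := \row_i (mink_sign i * x 0 i).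

Let mink_flip x y : mink x (flip y) = dot x y.
Proof.
rewrite minkE; apply: eq_bigr => i _; rewrite mxE /mink_sign.
by case: ifP => _; ring.
Qed.

Let dot_eq0 x : dot x x = 0 -> x = 0.
Proof.
move=> xx; apply/rowP => i; rewrite mxE; apply/eqP.
rewrite -sqrf_eq0 expr2; apply/eqP.
by apply: (psumr_eq0P _ xx) => // k _; rewrite -expr2 sqr_ge0.
Qed.

Let dotZ (a b : R) x y y' : dot x (a *: y - b *: y') = a * dot x y - b * dot x y'.
Proof.
rewrite /dot !mulr_sumr -sumrB; apply: eq_bigr => i _; rewrite !mxE; ring.
Qed.

Let dotC x y : dot x y = dot y x.
Proof. by apply: eq_bigr => i _; rewrite mulrC. Qed.

(** If [q] and [m] are not proportional then some vector is orthogonal to [m]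
    and not to [q]: the Euclidean component of [q] orthogonal to [m], with its
    time coordinate reversed. *)
Lemma mink_separate (m q : 'rV[R]_n.+1) : m != 0 -> q != 0 ->
  (forall lam, m != lam *: q) -> exists2 e, mink m e = 0 & mink q e != 0.
Proof.
move=> m0 q0 mq; pose e' := dot m m *: q - dot m q *: m.
have me : dot m e' = 0 by rewrite dotZ; ring.
exists (flip e'); rewrite mink_flip //; apply/eqP => qe.
have e0 : e' = 0 by apply: dot_eq0; rewrite {2}/e' dotZ (dotC _ q) qe (dotC _ m) me; ring.
have mm0 : dot m m != 0 by apply: contra m0 => /eqP/dot_eq0 ->.
have E : dot m m *: q = dot m q *: m by apply/eqP; rewrite -subr_eq0 -/e' e0.
have mq0 : dot m q != 0.
  apply: contra q0 => /eqP mq0; move/eqP: E.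
  by rewrite mq0 scale0r scaler_eq0 (negPf mm0).
have /eqP := mq ((dot m q)^-1 * dot m m); apply.
by rewrite -scalerA E scalerA mulVf ?scale1r.
Qed.

(** A line through [p] in the hyperplane, neither light-like nor tangent to the
    hypersphere, meets the hypersphere at a second point. A light-like direction
    is corrected by a space-like vector orthogonal to all data. *)
Lemma codim2_sphere_two_points (S : set 'rV[R]_n.+1) p : (4 <= n)%N ->
  codim2_sphere S -> S p -> exists2 q, S q & q != p.
Proof.
move=> hn [c [rho [m [d [rho0 m0 SE _ Sm]]]]] Sp.
have := Sp; rewrite SE => -[/= pc pm].
have [Q QE] : exists Q, Q = p - c by exists (p - c).
have QQ : mink Q Q = - rho ^+ 2 by rewrite QE; exact: pc.
have Q0 : Q != 0.
  apply/eqP => Q0; move/eqP: QQ.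
  by rewrite Q0 mink0l eq_sym oppr_eq0 sqrf_eq0 gt_eqF.
have mQ lam : m != lam *: Q by rewrite QE; exact: Sm.
have [e0 me0 Qe0] := mink_separate m0 Q0 mQ.
(* Four linear conditions on a vector of a space of dimension [n + 1 > 4]; the
   first one makes the time coordinate vanish. *)
have [f f0 fv] := @mink_orthogonal_exists 4
  (tnth [tuple delta_mx 0 ord_max; m; Q; e0]) hn.
have ft : f 0 ord_max = 0.
  have := fv 0; rewrite minkC mink_delta /mink_sign eqxx mulN1r => /eqP.
  by rewrite oppr_eq0 => /eqP.
have mf : mink m f = 0 := fv 1.
have Qf : mink Q f = 0 := fv 2.
have e0f : mink e0 f = 0 := fv 3.
have ff := mink_gt0_spatial f0 ft.
have [e [me Qe ee]] : exists e, [/\ mink m e = 0, mink Q e != 0 & mink e e != 0].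
  have [ee|ee] := eqVneq (mink e0 e0) 0; last by exists e0.
  exists (e0 + f); split; first by rewrite minkDr me0 mf addr0.
    by rewrite minkDr Qf addr0.
  by rewrite minkDr !minkDl ee (minkC f) e0f !add0r gt_eqF.
pose t := - 2 * mink Q e / mink e e.
have t0 : t != 0 by rewrite !mulf_neq0 ?invr_eq0 // oppr_eq0 pnatr_eq0.
have tE : p + t *: e - c = Q + t *: e by rewrite QE addrAC.
have tS : mink (p + t *: e - c) (p + t *: e - c) = - rho ^+ 2.
  by rewrite tE minkDl !minkDr !minkZl !minkZr QQ (minkC e) /t; field.
exists (p + t *: e).
  by split; [exact: tS|rewrite /= minkDr minkZr me mulr0 addr0].
rewrite -subr_eq0 addrAC subrr add0r scaler_eq0 (negPf t0) /=.
by apply: contra Qe => /eqP ->; rewrite minkC mink0l.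
Qed.

End SphereSections.

(** * Local parametrizations *)

Section LocalParametrizations.
Context {R : realType} {n : nat}.
Variables (M : set 'rV[R]_n.+1) (U : set 'rV[R]_n) (X : 'rV[R]_n -> 'rV[R]_n.+1).
Hypothesis (hX : local_param M U X).

Lemma local_param_open : open U. Proof. by case: hX. Qed.

Lemma local_param_Ck k : Ck k U X.
Proof. by case: hX => _ /smooth_onP + _ _ _; exact. Qed.

Lemma local_param_differentiable u : U u -> differentiable X u.
Proof. exact: Ck_differentiable (local_param_Ck 0). Qed.

Lemma local_param_mem u : U u -> M (X u).
Proof.
move=> Uu; case: hX => oU _ _ _ /(_ U oU (@subset_refl _ U))[V [_ XV]].
have : (X @` U) (X u) by exists u.
by rewrite XV => -[].
Qed.

Lemma local_param_tangent u a : U u -> tangent M (X u) ('D_a X u).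
Proof. by move=> Uu; exists U, X, u, a; split. Qed.

Lemma local_param_frame_free u : U u -> row_free (frame X u).
Proof.
move=> Uu; apply/inj_row_free => a; rewrite -derive_frame; last first.
  exact: local_param_differentiable.
by case: hX => _ _ + _ _; exact.
Qed.

Lemma metric_formE u a b : U u ->
  metric_form (induced_metric X) u a b = mink ('D_a X u) ('D_b X u).
Proof.
move=> Uu; have dX := local_param_differentiable Uu.
rewrite (derive_rowE a dX) (derive_rowE b dX) mink_suml /metric_form.
apply: eq_bigr => i _; rewrite mink_sumr; apply: eq_bigr => j _.
by rewrite minkZl minkZr mxE -mulrA mulrC -mulrA.
Qed.

(** A vector orthogonal to a nonzero normal is tangent, for dimension reasons. *)
Lemma tangent_of_orthogonal u x y : U u -> x != 0 ->
  (forall a, mink x ('D_a X u) = 0) -> mink x y = 0 -> exists a, y = 'D_a X u.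
Proof.
move=> Uu x0 xX xy.
have [i|a ya] := mink_orthogonal_span (local_param_frame_free Uu) x0 _ xy.
  by rewrite rowK xX.
by exists a; rewrite derive_frame //; exact: local_param_differentiable.
Qed.

End LocalParametrizations.

(** * Geometry of canal hypersurfaces *)

Section Canal.
Context {R : realType} {n : nat}.
Variables (M : set 'rV[R]_n.+1) (J : set R) (S : R -> set 'rV[R]_n.+1)
  (z : R -> 'rV[R]_n.+1) (r : R -> R).
Hypotheses (hn : (4 <= n)%N) (hM : canal_spacelike_hypersurface M J S z r).
Local Notation z1 := (fun t => 'D_1 z t).
Local Notation r1 := (fun t => 'D_1 r t).

Let hypM : hypersurface M. Proof. by case: hM => -[]. Qed.
Let spM : spacelike M. Proof. by case: hM => -[]. Qed.
Let oJ : open J. Proof. by case: hM => _ []. Qed.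
Let ME : M = \bigcup_(s in J) S s. Proof. by case: hM => _ _ []. Qed.
Let codS s : J s -> codim2_sphere (S s).
Proof. by case: hM => _ _ [_ +] _ _; exact. Qed.
Let famS : smooth_family M J S. Proof. by case: hM. Qed.
Let cz k : Ck k J z. Proof. by case: hM => _ _ _ _ [[/smooth_onP + _] _ _ _ _]; exact. Qed.
Let cr k : Ck k J r. Proof. by case: hM => _ _ _ _ [[_ /smooth_onP +] _ _ _ _]; exact. Qed.
Let z1_neq0 s : J s -> 'D_1 z s != 0.
Proof. by move=> Js; case: hM => _ _ _ _ [_ /(_ s Js)]; rewrite derive1E. Qed.
Let r_gt0 s : J s -> 0 < r s.
Proof. by case: hM => _ _ _ _ [_ _ + _ _]; exact. Qed.
Let r_neq0 s : J s -> r s != 0.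
Proof. by move=> /r_gt0; rewrite lt0r => /andP[]. Qed.
Let normal_through s p : J s -> S s p -> normal_line_through M p (z s).
Proof. by case: hM => _ _ _ _ [_ _ _ + _]; exact. Qed.
Let sphere_eq s p : J s -> S s p -> mink (p - z s) (p - z s) = - r s ^+ 2.
Proof. by case: hM => _ _ _ _ [_ _ _ _]; exact. Qed.

Let dz s : J s -> differentiable z s. Proof. exact: Ck_differentiable (cz 0). Qed.
Let dr s : J s -> differentiable r s. Proof. exact: Ck_differentiable (cr 0). Qed.
Let dz1 s : J s -> differentiable z1 s.
Proof. move=> Js; exact: (Ck_differentiable (@Ck_derive R _ _ _ J z 1 (cz 1%N)) Js). Qed.
Let dr1 s : J s -> differentiable r1 s.
Proof. move=> Js; exact: (Ck_differentiable (@Ck_derive R _ _ _ J r 1 (cr 1%N)) Js). Qed.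

Let MS p : M p -> exists2 s, J s & S s p.
Proof. by rewrite ME => -[s]; exists s. Qed.

Let SM s p : J s -> S s p -> M p. Proof. by rewrite ME; exists s. Qed.

Let radius_orthogonal U X u s a : local_param M U X -> U u -> J s -> S s (X u) ->
  mink (X u - z s) ('D_a X u) = 0.
Proof.
move=> hX Uu Js Sp; have [w [nw zE]] := normal_through Js Sp.
have -> : X u - z s = - w by rewrite zE opprD addrA subrr add0r.
by rewrite minkNl (nw _ (local_param_tangent hX a Uu)) oppr0.
Qed.

(** The parameter of the generators as a function on a chart. *)
Lemma generator_chart U X u s : local_param M U X -> U u -> J s -> S s (X u) ->
  exists (U0 : set 'rV[R]_n) (tau : 'rV[R]_n -> R),
    [/\ open U0 /\ U0 u, U0 `<=` U, (forall k, Ck k U0 tau), tau u = s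
      & forall v, U0 v -> J (tau v) /\ S (tau v) (X v)].
Proof.
move=> hX Uu Js Sp.
have [V [sigma [[oV Vp] /smooth_onP csigma sp SV _]]] := famS Js Sp.
have [oU cX] := (local_param_open hX, local_param_Ck hX).
have oU0 : open (U `&` X @^-1` V).
  rewrite openE => v [Uv Vv]; apply: filterI; first exact: open_nbhs_nbhs.
  have cXv := differentiable_continuous (local_param_differentiable hX Uv).
  by apply: cXv; exact: open_nbhs_nbhs.
have subU : U `&` X @^-1` V `<=` U by move=> v [].
exists (U `&` X @^-1` V), (fun v => sigma (X v)); split => //.
- move=> k; apply: (Ck_comp_row oU0 _ (csigma k)); first by move=> v [].
  exact: sub_Ck subU (cX k).
- move=> v [Uv Vv]; apply: SV => //; exact: local_param_mem hX _ Uv.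
Qed.

Let derive_center (X : 'rV[R]_n -> 'rV[R]_n.+1) (tau : 'rV[R]_n -> R) u a :
  differentiable X u -> differentiable tau u -> J (tau u) ->
  differentiable (fun v => X v - z (tau v)) u /\
  'D_a (fun v => X v - z (tau v)) u = 'D_a X u - 'D_a tau u *: 'D_1 z (tau u).
Proof.
move=> dX dt Jt.
have dzt : differentiable (fun v => z (tau v)) u.
  exact: (differentiable_comp dt (dz Jt)).
split; first exact: differentiableB.
rewrite [LHS]deriveB; [|exact: diff_derivable|exact: diff_derivable].
by congr (_ - _); exact: (derive_comp1 a dt (dz Jt)).
Qed.

(** Differentiate the sphere equation in a tangent direction along which the
    parameter varies. *)
Lemma center_velocity s p : J s -> S s p ->
  mink (p - z s) ('D_1 z s) = r s * 'D_1 r s.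
Proof.
move=> Js Sp.
have [V [sigma [[oV Vp] /smooth_onP csigma sp SV [v [tv sv]]]]] := famS Js Sp.
case: tv => U [X [u [a [hX Uu Xu Xa]]]].
have dX := local_param_differentiable hX Uu.
have dsig : differentiable sigma (X u).
  by rewrite Xu; exact: Ck_differentiable (csigma 0) Vp.
pose tau v := sigma (X v).
have dtau : differentiable tau u by exact: (differentiable_comp dX dsig).
have tu : tau u = s by rewrite /tau Xu.
have Jt : J (tau u) by rewrite tu.
have [dc Dc] := derive_center a dX dtau Jt.
have drt : differentiable (fun v => r (tau v)) u.
  exact: (differentiable_comp dtau (dr Jt)).
have E0 : 'D_a (fun v => mink (X v - z (tau v)) (X v - z (tau v)) +
                         r (tau v) * r (tau v)) u = 0.
  rewrite (@near_eq_derive _ _ _ _ (fun=> 0)) ?derive_cst //.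
  have nV : \near u, V (X u).
    by apply: (differentiable_continuous dX); apply: open_nbhs_nbhs; rewrite Xu.
  apply: filterS2 (near_open (local_param_open hX) Uu) nV => y Uy Vy.
  have [Jy Sy] := SV _ (local_param_mem hX Uy) Vy.
  by rewrite sphere_eq // expr2 addNr.
have E1 : 'D_a (fun v => mink (X v - z (tau v)) (X v - z (tau v)) +
                         r (tau v) * r (tau v)) u =
  - 2 * 'D_a tau u * (mink (p - z s) ('D_1 z s) - r s * 'D_1 r s).
  rewrite [LHS]deriveD; last 2 first.
  - by apply: diff_derivable; exact: differentiable_mink.
  - by apply: diff_derivable; exact: differentiableMf.
  rewrite derive_mink // Dc deriveMf // (derive_comp1 _ dtau (dr Jt)) tu Xu.
  rewrite minkC minkDr minkNr minkZr -{1 3}Xu.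
  by rewrite (radius_orthogonal _ hX Uu Js) ?Xu // /GRing.scale /=; ring.
have ta : 'D_a tau u != 0 by rewrite (derive_comp _ dX dsig) Xa Xu.
have /eqP := etrans (esym E1) E0.
by rewrite !mulf_eq0 oppr_eq0 pnatr_eq0 (negPf ta) /= subr_eq0 => /eqP.
Qed.

Definition canal_vector s p := derive1 z s - derive1 r s *: canal_normal z r s p.

Local Notation w := canal_vector.

Lemma canal_vectorE s p : w s p = 'D_1 z s + ('D_1 r s / r s) *: (p - z s).
Proof. by rewrite /w /canal_normal scalerN opprK !derive1E scalerA. Qed.

Lemma canal_vector_orthogonal s p : J s -> S s p -> mink (p - z s) (w s p) = 0.
Proof.
move=> Js Sp; have r0 := r_neq0 Js.
rewrite canal_vectorE minkDr minkZr center_velocity // sphere_eq //.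
by field.
Qed.

Let radius_neq0 s p : J s -> S s p -> p - z s != 0.
Proof.
move=> Js Sp; apply/eqP => p0; have := sphere_eq Js Sp.
by rewrite p0 mink0l => /eqP; rewrite eq_sym oppr_eq0 sqrf_eq0 (negPf (r_neq0 Js)).
Qed.

Let tangent_orthogonal U X u s y : local_param M U X -> U u -> J s -> S s (X u) ->
  mink (X u - z s) y = 0 -> exists a, y = 'D_a X u.
Proof.
move=> hX Uu Js Sp; apply: (tangent_of_orthogonal hX Uu (radius_neq0 Js Sp)) => a.
exact: (radius_orthogonal a hX Uu Js Sp).
Qed.

Let orthogonal_gt0 s p y : J s -> S s p -> mink (p - z s) y = 0 -> y != 0 ->
  0 < mink y y.
Proof.
move=> Js Sp py y0; have Mp := SM Js Sp.
have [U [X [u [hX Uu Xu]]]] := hypM Mp.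
apply: (spM Mp) => //; move: Sp py; rewrite -Xu => Sp py.
have [a ->] := tangent_orthogonal hX Uu Js Sp py.
exact: (local_param_tangent hX a Uu).
Qed.

(** If the vector vanished at [p], the generator would lie in the hyperplane
    tangent to the hypersphere at [p], hence be reduced to [p]. *)
Lemma canal_vector_gt0 s p : J s -> S s p -> 0 < mink (w s p) (w s p).
Proof.
move=> Js Sp; apply: (orthogonal_gt0 Js Sp); first exact: canal_vector_orthogonal.
apply/eqP => w0; have r0 := r_neq0 Js.
have z1E : 'D_1 z s = - ('D_1 r s / r s) *: (p - z s).
  by apply/eqP; rewrite scaleNr -addr_eq0 -canal_vectorE w0.
have r10 : 'D_1 r s != 0.
  by apply/eqP => r10; have := z1_neq0 Js; rewrite z1E r10 mul0r oppr0 scale0r eqxx.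
have [q Sq qp] := codim2_sphere_two_points hn (codS Js) Sp.
have qpz : mink (q - z s) (p - z s) = - r s ^+ 2.
  have := center_velocity Js Sq; rewrite z1E minkZr => E.
  have k0 : - ('D_1 r s / r s) != 0 by rewrite oppr_eq0 mulf_neq0 ?invr_eq0.
  by apply: (mulfI k0); rewrite E; field.
have qpE : q - p = (q - z s) - (p - z s) by rewrite opprB addrA subrK.
have pp := sphere_eq Js Sp; have qq := sphere_eq Js Sq.
have qp0 : mink (q - p) (q - p) = 0.
  by rewrite qpE mink_sqrB qpz pp qq; ring.
have pqp : mink (p - z s) (q - p) = 0.
  by rewrite qpE minkDr minkNr (minkC (p - z s) (q - z s)) qpz pp subrr.
by have := orthogonal_gt0 Js Sp pqp; rewrite qp0 ltxx subr_eq0 => /(_ qp).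
Qed.

Let Ck_radius U0 tau (X : 'rV[R]_n -> 'rV[R]_n.+1) k :
  open U0 -> (forall v, U0 v -> J (tau v)) ->
  Ck k U0 tau -> Ck k U0 X -> Ck k U0 (fun v => X v - z (tau v)).
Proof.
move=> oU0 U0J ct cX.
have czt : Ck k U0 (fun v => z (tau v)) := Ck_comp1_row oU0 oJ U0J (cz k) ct.
apply: (eq_Ck oU0 _ (CkD oU0 cX (CkZ oU0 (Ck_cst _ k (-1 : R)) czt))) => v _.
by rewrite scaleN1r.
Qed.

Let Ck_normal U0 tau (X : 'rV[R]_n -> 'rV[R]_n.+1) k :
  open U0 -> (forall v, U0 v -> J (tau v)) ->
  Ck k U0 tau -> Ck k U0 X -> Ck k U0 (fun v => canal_normal z r (tau v) (X v)).
Proof.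
move=> oU0 U0J ct cX.
have crt : Ck k U0 (fun v => r (tau v)) := Ck_comp1 oU0 U0J (cr k) ct.
have crV : Ck k U0 (fun v => (r (tau v))^-1).
  by apply: (Ck_comp1 oU0 _ (Ck_inv k) crt) => v /U0J/r_neq0.
have h := CkZ oU0 crV (Ck_radius oU0 U0J ct cX).
apply: (eq_Ck oU0 _ (CkZ oU0 (Ck_cst _ k (-1 : R)) h)) => v _.
by rewrite scaleN1r.
Qed.

Lemma Ck_canal_direction U0 tau (X : 'rV[R]_n -> 'rV[R]_n.+1) k : open U0 ->
  (forall v, U0 v -> J (tau v) /\ S (tau v) (X v)) ->
  Ck k U0 tau -> Ck k U0 X -> Ck k U0 (fun v => canal_direction z r (tau v) (X v)).
Proof.
move=> oU0 U0JS ct cX.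
have U0J v : U0 v -> J (tau v) by case/U0JS.
have cz1 : Ck k J z1 := @Ck_derive R _ _ k J z 1 (cz k.+1).
have cr1 : Ck k J r1 := @Ck_derive R _ _ k J r 1 (cr k.+1).
have czt : Ck k U0 (fun v => z1 (tau v)) := Ck_comp1_row oU0 oJ U0J cz1 ct.
have crt : Ck k U0 (fun v => r1 (tau v)) := Ck_comp1 oU0 U0J cr1 ct.
have h := CkZ oU0 crt (Ck_normal oU0 U0J ct cX).
have cw : Ck k U0 (fun v => w (tau v) (X v)).
  apply: (eq_Ck oU0 _ (CkD oU0 czt (CkZ oU0 (Ck_cst _ k (-1 : R)) h))) => v _.
  by rewrite scaleN1r /w !derive1E.
have cww := Ck_mink oU0 cw cw.
have w_gt0 v : U0 v -> 0 < mink (w (tau v) (X v)) (w (tau v) (X v)).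
  by case/U0JS; exact: canal_vector_gt0.
have cn : Ck k U0 (fun v => mnorm (w (tau v) (X v))).
  exact: (Ck_comp1 oU0 w_gt0 (Ck_sqrt k) cww).
have cnV : Ck k U0 (fun v => (mnorm (w (tau v) (X v)))^-1).
  apply: (Ck_comp1 oU0 _ (Ck_inv k) cn) => v /w_gt0 ww /=.
  by rewrite /mnorm gt_eqF ?sqrtr_gt0.
exact: (CkZ oU0 cnV cw).
Qed.

Lemma canal_direction_unit s p : J s -> S s p ->
  mink (canal_direction z r s p) (canal_direction z r s p) = 1.
Proof.
move=> Js Sp; have ww := canal_vector_gt0 Js Sp.
rewrite /canal_direction -/(w s p) minkZl minkZr mulrA -expr2 exprVn /mnorm.
by rewrite sqr_sqrtr ?ltW // mulVf ?gt_eqF.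
Qed.

Lemma canal_direction_tangent U X u s : local_param M U X -> U u -> J s ->
  S s (X u) -> exists c, canal_direction z r s (X u) = 'D_c X u.
Proof.
move=> hX Uu Js Sp; apply: (tangent_orthogonal hX Uu Js Sp).
by rewrite /canal_direction minkZr -/(w s (X u)) canal_vector_orthogonal ?mulr0.
Qed.

(** The factor of proportionality between the covector dual to [canal_vector] and
    the differential of the parameter. It depends on the point alone, not on a
    chart, and so does the curvature function built from it. *)
Definition param_factor s p : R :=
  mink ('D_1 z s) ('D_1 z s) - mink (p - z s) ('D_1 z1 s) +
  ('D_1 r s * 'D_1 r s + r s * 'D_1 r1 s).

(** Differentiate the identity of [center_velocity] along the chart. *)
Lemma param_factorE (U : set 'rV[R]_n) X u (tau : 'rV[R]_n -> R) b :
  open U -> U u -> differentiable X u -> differentiable tau u ->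
  (forall v, U v -> J (tau v) /\ S (tau v) (X v)) ->
  mink ('D_b X u) ('D_1 z (tau u)) = 'D_b tau u * param_factor (tau u) (X u).
Proof.
move=> oU Uu dX dtau UJS; have [Jt St] := UJS _ Uu.
have [dc Dc] := derive_center b dX dtau Jt.
have dz1t : differentiable (fun v => z1 (tau v)) u.
  exact: (differentiable_comp dtau (dz1 Jt)).
have drt : differentiable (fun v => r (tau v)) u.
  exact: (differentiable_comp dtau (dr Jt)).
have dr1t : differentiable (fun v => r1 (tau v)) u.
  exact: (differentiable_comp dtau (dr1 Jt)).
have E : 'D_b (fun v => mink (X v - z (tau v)) (z1 (tau v))) u =
         'D_b (fun v => r (tau v) * r1 (tau v)) u.
  apply: near_eq_derive; apply: filterS (near_open oU Uu) => v /UJS[Jv Sv].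
  exact: center_velocity.
have E1 := derive_mink b dc dz1t.
rewrite Dc (derive_comp1 b dtau (dz1 Jt)) minkZr in E1.
have F1 x y (t : R) v : mink (x - t *: y) v = mink x v - t * mink y v.
  by rewrite minkDl minkNl minkZl.
rewrite F1 in E1.
have E2 := deriveMf b drt dr1t.
rewrite (derive_comp1 b dtau (dr Jt)) (derive_comp1 b dtau (dr1 Jt)) in E2.
have aux (A t B C q q1 q2 : R) :
    A - t * B + t * C = t * q1 * q1 + q * (t * q2) ->
    A = t * (B - C + (q1 * q1 + q * q2)).
  move=> AE; have -> : A = (A - t * B + t * C) + t * B - t * C by ring.
  by rewrite AE; ring.
exact: (aux _ _ _ _ _ _ _ (etrans (esym E1) (etrans E E2))).
Qed.

(** With [N] the normal, [r dN = dtau w - dX]; pairing with tangent vectors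
    turns [w] into a multiple of the differential of the parameter. *)
Lemma canal_second_form (U : set 'rV[R]_n) X u (tau : 'rV[R]_n -> R) a b :
  local_param M U X ->
  forall U0, open U0 -> U0 `<=` U -> U0 u -> (forall k, Ck k U0 tau) ->
  (forall v, U0 v -> J (tau v) /\ S (tau v) (X v)) ->
  mink ('D_a (fun v => canal_normal z r (tau v) (X v)) u) ('D_b X u) =
  (r (tau u))^-1 * (param_factor (tau u) (X u) * 'D_a tau u * 'D_b tau u -
                    mink ('D_a X u) ('D_b X u)).
Proof.
move=> hX U0 oU0 U0U Uu ctau UJS; have [Jt St] := UJS _ Uu.
have dX := local_param_differentiable hX (U0U _ Uu).
have dtau : differentiable tau u := Ck_differentiable (ctau 0) Uu.
have U0J v : U0 v -> J (tau v) by case/UJS.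
have cX : Ck 0 U0 X by exact: sub_Ck U0U (local_param_Ck hX 0).
have dN := Ck_differentiable (Ck_normal oU0 U0J (ctau 0) cX) Uu.
have [dc Dc] := derive_center a dX dtau Jt.
have drV : differentiable (fun v => (r (tau v))^-1) u.
  by apply: differentiableV (r_neq0 Jt); exact: (differentiable_comp dtau (dr Jt)).
set Y := 'D_b X u.
have dY : differentiable (fun _ : 'rV[R]_n => Y) u by exact: differentiable_cst.
have E1 := derive_mink a dN dY.
have E2 : 'D_a (fun v => mink (canal_normal z r (tau v) (X v)) Y) u =
          'D_a (fun v => (r (tau v))^-1 * (- mink (X v - z (tau v)) Y)) u.
  congr (derive _ _ _); apply/funext => v.
  by rewrite /canal_normal minkNl minkZl mulrN.
have dcY : differentiable (fun v => mink (X v - z (tau v)) Y) u.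
  exact: differentiable_mink.
have dcYN : differentiable (fun v => - mink (X v - z (tau v)) Y) u.
  exact: differentiableN.
have E3 := deriveMf a drV dcYN.
have E4 : 'D_a (fun v => - mink (X v - z (tau v)) Y) u =
          - (mink ('D_a X u) Y - 'D_a tau u * mink ('D_1 z (tau u)) Y).
  rewrite [LHS]deriveN; last exact: diff_derivable.
  rewrite (derive_mink a dc dY) Dc derive_cst (minkC _ 0) mink0l addr0.
  by rewrite minkDl minkNl minkZl.
have E5 : mink (X u - z (tau u)) Y = 0.
  exact: (radius_orthogonal b hX (U0U _ Uu) Jt St).
have E6 := param_factorE b oU0 Uu dX dtau UJS.
rewrite derive_cst (minkC _ 0) mink0l addr0 in E1.
rewrite -E1 E2; apply: (etrans E3); rewrite E4 E5 oppr0 mulr0 add0r.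
rewrite -/Y minkC in E6; rewrite E6.
have aux (k g f ta tb : R) : k * - (g - ta * (tb * f)) = k * (f * ta * tb - g).
  by ring.
exact: aux.
Qed.

(** The second fundamental form is a combination of the metric and of the square
    of the covector dual to the field, so for an orthonormal pair the Gauss
    equation leaves only the squared length of the projection of the field. *)
Lemma canal_sectional s p : J s -> S s p -> exists lam : R,
  forall x y k, orthonormal_pair x y -> curvature_of_plane M p x y k ->
  k = - (r s) ^- 2 * (1 - lam * (mink (canal_direction z r s p) x ^+ 2 +
                                 mink (canal_direction z r s p) y ^+ 2)).
Proof.
move=> Js Sp; pose W := mink (w s p) (w s p); pose f := param_factor s p.
have W0 : 0 < W := canal_vector_gt0 Js Sp.
exists (W / f) => x y k [xx yy xy] [U [X [u [a [b [hX Uu Xu [Xa Xb] ->]]]]]].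
move: Sp; rewrite -{1}Xu => Sp.
have [U0 [tau [[oU0 U0u] U0U ctau tu UJS]]] := generator_chart hX Uu Js Sp.
have dX := local_param_differentiable hX Uu.
have dtau : differentiable tau u := Ck_differentiable (ctau 0) U0u.
have U0J v : U0 v -> J (tau v) by case/UJS.
have cX k' : Ck k' U0 X by exact: sub_Ck U0U (local_param_Ck hX k').
have h a' b' := canal_second_form a' b' hX oU0 U0U U0u ctau UJS.
rewrite tu Xu -/f in h.
have wD c : mink (w s p) ('D_c X u) = 'D_c tau u * f.
  rewrite canal_vectorE minkDl minkZl -Xu (radius_orthogonal c hX Uu Js Sp).
  rewrite mulr0 addr0 minkC.
  by have := param_factorE c oU0 U0u dX dtau UJS; rewrite tu Xu.
have [c wc] : exists c, w s p = 'D_c X u.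
  apply: (tangent_orthogonal hX Uu Js Sp).
  by rewrite Xu canal_vector_orthogonal // -Xu.
have f0 : f != 0.
  have := wD c; rewrite -wc -/W => WE.
  by apply: contraTneq W0 => f0; rewrite WE f0 mulr0 ltxx.
have r0 := r_neq0 Js.
have G := @gauss_equation R n U0 X (fun v => canal_normal z r (tau v) (X v))
  oU0 (cX 3) _ _ _ _ u a b U0u.
have {}G := G (fun v Uv => Ck_differentiable (Ck_normal oU0 U0J (ctau 0) (cX 0)) Uv).
have {}G : metric_form (induced_metric X) u (riemann (induced_metric X) u a b b) a =
  (r s)^-1 ^+ 2 * ((f * 'D_a tau u * 'D_b tau u - mink ('D_a X u) ('D_b X u)) ^+ 2 -
   (f * 'D_b tau u * 'D_b tau u - mink ('D_b X u) ('D_b X u)) *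
   (f * 'D_a tau u * 'D_a tau u - mink ('D_a X u) ('D_a X u))).
  have aux (q f' ta tb gab gba gaa gbb p1 p2 p3 p4 : R) :
    p1 = q * (f' * ta * tb - gab) -> p2 = q * (f' * tb * ta - gba) ->
    p3 = q * (f' * tb * tb - gbb) -> p4 = q * (f' * ta * ta - gaa) -> gba = gab ->
    p1 * p2 - p3 * p4 = q ^+ 2 * ((f' * ta * tb - gab) ^+ 2 -
      (f' * tb * tb - gbb) * (f' * ta * ta - gaa)).
    by move=> -> -> -> -> ->; ring.
  apply: etrans (G _ _ _) (aux _ _ _ _ _ _ _ _ _ _ _ _
    (h a b) (h b a) (h b b) (h a a) (minkC _ _)).
  - move=> v /UJS[Jv Sv]; rewrite /canal_normal minkNl minkNr opprK minkZl minkZr.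
    by rewrite sphere_eq //; have := r_neq0 Jv => rv; field.
  - move=> v i Uv; have [Jv Sv] := UJS _ Uv.
    rewrite /canal_normal minkNl minkZl.
    by rewrite (radius_orthogonal _ hX (U0U _ Uv) Jv Sv) mulr0 oppr0.
  - by move=> v Uv; exact: (local_param_frame_free hX (U0U _ Uv)).
have Aab := metric_formE hX a b Uu; have Aaa := metric_formE hX a a Uu.
have Abb := metric_formE hX b b Uu.
have xiE c' : mink (canal_direction z r s p) ('D_c' X u) ^+ 2 =
              W^-1 * ('D_c' tau u * f) ^+ 2.
  rewrite /canal_direction -/(w s p) minkZl wD exprMn exprVn /mnorm sqr_sqrtr //.
  exact: ltW.
rewrite -Xa -Xb in xx yy xy *.
have aux (N A B C q X2 Y2 ta tb gab gaa gbb : R) :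
  N = q ^+ 2 * ((f * ta * tb - gab) ^+ 2 - (f * tb * tb - gbb) * (f * ta * ta - gaa)) ->
  A = gaa -> B = gbb -> C = gab -> gaa = 1 -> gbb = 1 -> gab = 0 ->
  X2 = W^-1 * (ta * f) ^+ 2 -> Y2 = W^-1 * (tb * f) ^+ 2 ->
  N / (A * B - C ^+ 2) = - q ^+ 2 * (1 - W / f * (X2 + Y2)).
  have W1 : W != 0 by rewrite gt_eqF.
  move=> -> -> -> -> -> -> -> -> ->.
  have -> : 1 * 1 - 0 ^+ 2 = 1 :> R by ring.
  by rewrite divr1; field; rewrite W1 f0.
have -> : (r s) ^- 2 = (r s)^-1 ^+ 2 by rewrite exprVn.
exact: (aux _ _ _ _ _ _ _ _ _ _ _ _ G Aaa Abb Aab xx yy xy (xiE a) (xiE b)).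
Qed.

End Canal.

(** * Quasi-constant curvature *)

(** Bessel's inequality, in the form that the remainder of the projection of a
    unit vector has nonnegative square. *)
Lemma mink_projection_le1 (R : realType) (n : nat) (x y v : 'rV[R]_n.+1) :
  orthonormal_pair x y -> mink v v = 1 ->
  0 <= mink (v - (mink v x *: x + mink v y *: y))
            (v - (mink v x *: x + mink v y *: y)) ->
  mink v x ^+ 2 + mink v y ^+ 2 <= 1.
Proof.
move=> [xx yy xy] vv; rewrite mink_sqrB !minkDr !minkDl !minkZl !minkZr.
by rewrite vv xx yy xy (minkC y) xy; nra.
Qed.

Theorem mainTheorem2 (R : realType) (n : nat) (hn : (4 <= n)%N)
  (M : set 'rV[R]_n.+1) (J : set R) (S : R -> set 'rV[R]_n.+1)
  (z : R -> 'rV[R]_n.+1) (r : R -> R) (xi : 'rV[R]_n.+1 -> 'rV[R]_n.+1)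
  (hM : canal_spacelike_hypersurface M J S z r)
  (hxi : forall s p, J s -> S s p -> xi p = canal_direction z r s p) :
  QC_manifold M xi /\
  (forall p k, M p -> horizontal_curvature M xi p k -> k < 0).
Proof.
have [[hypM spM] [oJ _] [ME _] _ [_ _ r_gt0 _ _]] := hM.
have MS p : M p -> exists2 s, J s & S s p by rewrite ME => -[s]; exists s.
have curv := @canal_sectional _ _ _ _ _ _ _ hn hM.
have xi1 p : M p -> mink (xi p) (xi p) = 1.
  by move=> /MS[s Js Sp]; rewrite (hxi s) //; exact: (canal_direction_unit hn hM Js Sp).
have xiT U X u : local_param M U X -> U u -> exists c, xi (X u) = 'D_c X u.
  move=> hX Uu; have [s Js Sp] := MS _ (local_param_mem hX Uu).
  rewrite (hxi s) //; exact: (canal_direction_tangent hM hX Uu Js Sp).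
split; last first.
  move=> p k /MS[s Js Sp] [x [y [xy xix xiy kE]]].
  have [lam /(_ x y k xy kE)] := curv s p Js Sp.
  rewrite -(hxi s) // xix xiy expr0n /= addr0 mulr0 subr0 mulr1 => ->.
  by rewrite oppr_lt0 invr_gt0 exprn_gt0 ?r_gt0.
split=> //.
  split=> // [p Mp|U X hX vs u Uu].
    have [U [X [u [hX Uu <-]]]] := hypM _ Mp; have [c ->] := xiT _ _ _ hX Uu.
    exact: (local_param_tangent hX c Uu).
  have [s Js Sp] := MS _ (local_param_mem hX Uu).
  have [U0 [tau [[oU0 U0u] U0U ctau _ UJS]]] := generator_chart hM hX Uu Js Sp.
  suff /smooth_onP : forall k, Ck k U0 (xi \o X) by move=> /(_ vs u); exact.
  move=> k; have cX : Ck k U0 X := sub_Ck U0U (local_param_Ck hX k).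
  apply: (eq_Ck oU0 _ (Ck_canal_direction hn hM oU0 UJS (ctau k) cX)) => v Uv.
  by have [Jv Sv] := UJS _ Uv; rewrite /= (hxi (tau v)).
move=> p Mp; have [s Js Sp] := MS _ Mp; have [lam curvE] := curv s p Js Sp.
(* The argument of the arc cosine is the length of the projection of a unit
   vector, hence lies in [[0, 1]] and is recovered by the cosine. *)
exists (fun th => - (r s) ^- 2 * (1 - lam * cos th ^+ 2)) => x y k xy kE.
rewrite (curvE x y k xy kE) -(hxi s) //.
set q := mink (xi p) x ^+ 2 + mink (xi p) y ^+ 2.
have q0 : 0 <= q by rewrite addr_ge0 ?sqr_ge0.
have q1 : q <= 1.
  apply: mink_projection_le1 => //; first exact: xi1.
  case: kE => U [X [u [a [b [hX Uu Xu [Xa Xb] _]]]]].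
  have [c xc] := xiT _ _ _ hX Uu; rewrite Xu in xc.
  set v := xi p - _.
  have vE : v = 'D_(c - (mink (xi p) x *: a + mink (xi p) y *: b)) X u.
    rewrite /v; move: (mink _ _) (mink _ _) => A B; rewrite xc -Xa -Xb.
    have dX := local_param_differentiable hX Uu.
    by rewrite !derive_frame // mulmxBl mulmxDl !scalemxAl.
  (* The remainder is tangent, hence zero or space-like. *)
  have [->|v0] := eqVneq v 0; first by rewrite mink0l.
  apply: ltW; apply: (spM p) => //; rewrite vE -Xu.
  exact: (local_param_tangent hX _ Uu).
have -> : plane_angle x y (xi p) = acos (Num.sqrt q).
  rewrite /plane_angle /mnorm xi1 // sqrtr1 divr1; congr (acos (Num.sqrt _)).
  have [xx yy xy0] := xy.
  by rewrite minkDl !minkDr !minkZl !minkZr xx yy xy0 (minkC y) xy0 /q; ring.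
rewrite acosK ?sqr_sqrtr // in_itv /=; apply/andP; split.
  by apply: le_trans (sqrtr_ge0 q); lra.
by rewrite -[leRHS]sqrtr1 ler_sqrt.
Qed.
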